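(* Let $K$ be a wall in $\{0\le x_1\le M\}$ that is directionally convex in the direction $x_1$. If propagation occurs for $K$, then $\bar v(x)=1$ for all $x\in\Omega$.
   Context: Standing setting: $N\ge2$, $x=(x_1,y)$, $y\in\mathbb R^{N-1}$. $f\in C^1(\mathbb R)$ is bistable: for some $\alpha\in(0,1)$, $f(0)=f(\alpha)=f(1)=0$, $f'(0)<0$, $f'(\alpha)>0$, $f'(1)<0$, $f<0$ on $(0,\alpha)$, $f>0$ on $(\alpha,1)$, $\int_0^1f>0$. Let $c>0$, $\phi$ be the unique traveling wave: $\phi''+c\phi'+f(\phi)=0$, $0<\phi<1$, $\phi(-\infty)=1$, $\phi(+\infty)=0$, $\phi(0)=\alpha$. A wall is a closed set $K\subset\{0\le x_1\le M\}$ (some $M>0$) with uniformly smooth boundary such that $\Omega:=\mathbb R^N\setminus K$ is connected. $\bar u$ is the unique entire solution of $u_t=\Delta u+f(u)$ in $\Omega$, $\partial_\nu u=0$ on $\partial\Omega$, with $0<\bar u<1$ and $\sup_{x\in\Omega}|\bar u(t,x)-\phi(x_1-ct)|\to0$ as $t\to-\infty$; the limit profile is $\bar v:=\lim_{t\to+\infty}\bar u(t,\cdot)$; propagation means $\bar v(x_1,y)\to1$ as $x_1\to+\infty$. $K$ is directionally convex in the direction $x_1$ if for some $a\in\mathbb R$: (i) for every line $\Lambda$ parallel to the $x_1$-axis, $K\cap\Lambda$ is either empty or a single line segment; (ii) $K\cap\{x_1=a\}=\pi(K)$, where $\pi(K)$ is the orthogonal projection of $K$ onto the hyperplane $\{x_1=a\}$.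 *)

(* Defs.v *)
From mathcomp Require Import all_boot all_order all_algebra.
From mathcomp Require Import all_classical all_reals all_analysis.
Set Implicit Arguments. Unset Strict Implicit. Unset Printing Implicit Defensive.
Import Order.TTheory GRing.Theory Num.Theory numFieldNormedType.Exports.
Local Open Scope classical_set_scope.
Local Open Scope ring_scope.

Section Defs.
Variables (R : realType) (n : nat).
Notation V := 'rV[R]_n.+2.

Definition x1 (x : V) : R := x 0 0.

Definition setx1 (x : V) (s : R) : V :=
  \row_j (if j == 0 then s else x 0 j).

Definition e_ (i : 'I_n.+2) : V := delta_mx 0 i.

Definition dpart (l : seq 'I_n.+2) (g : V -> R) : V -> R :=
  foldr (fun i h => fun x => derive h x (e_ i)) g l.

Definition grad (g : V -> R) (x : V) : V := \row_i derive g x (e_ i).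

Definition unif_smooth (g : V -> R) : Prop :=
  (forall (l : seq 'I_n.+2) x i, derivable (dpart l g) x (e_ i)) /\
  (forall l : seq 'I_n.+2, exists C : R, forall x, `|dpart l g x| <= C).

(* K is a closed set with uniformly smooth boundary, described by a uniformly
   smooth defining function g: K = {g <= 0}, boundary = {g = 0}, |grad g| >= delta > 0
   on the boundary; grad g points into Omega = complement of K (the outward normal
   of Omega is -grad g/|grad g|). *)
Definition smooth_defining (K : set V) (g : V -> R) : Prop :=
  unif_smooth g /\ K = [set x | g x <= 0] /\
  exists delta : R, 0 < delta /\ forall x, g x = 0 -> delta <= `|grad g x|.

Definition wall (K : set V) (g : V -> R) (M : R) : Prop :=
  0 < M /\ closed K /\ K `<=` [set x | 0 <= x1 x <= M] /\
  smooth_defining K g /\ connected (~` K).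

Definition dir_convex_x1 (K : set V) : Prop :=
  exists a : R,
    (forall x : V, [set s | K (setx1 x s)] = set0 \/
        exists p q : R, p <= q /\ [set s | K (setx1 x s)] = [set s | p <= s <= q]) /\
    [set x | K x /\ x1 x = a] = [set x | x1 x = a /\ exists s, K (setx1 x s)].

Definition bistable (f : R -> R) (alpha : R) : Prop :=
  0 < alpha < 1 /\
  (forall s, derivable f s 1) /\ continuous (derive1 f) /\
  f 0 = 0 /\ f alpha = 0 /\ f 1 = 0 /\
  derive1 f 0 < 0 /\ 0 < derive1 f alpha /\ derive1 f 1 < 0 /\
  (forall s, 0 < s < alpha -> f s < 0) /\
  (forall s, alpha < s < 1 -> 0 < f s) /\
  (0 < \int[@lebesgue_measure R]_(s in `[0%R, 1%R]) (f s)%:E)%E.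

Definition traveling_wave (f : R -> R) (c : R) (phi : R -> R) (alpha : R) : Prop :=
  (forall z, derivable phi z 1 /\ derivable (derive1 phi) z 1) /\
  (forall z, derive1 (derive1 phi) z + c * derive1 phi z + f (phi z) = 0) /\
  (forall z, 0 < phi z < 1) /\
  phi x @[x --> -oo] --> (1:R) /\ phi x @[x --> +oo] --> (0:R) /\
  phi 0 = alpha.

Definition entire_solution (f : R -> R) (K : set V) (g : V -> R) (u : R -> V -> R) : Prop :=
  {within [set p : R * V | closure (~` K) p.2], continuous (fun p => u p.1 p.2)} /\
  (forall t x, (~` K) x ->
     derivable (fun s => u s x) t 1 /\
     forall i, derivable (u t) x (e_ i) /\
               derivable (fun y => derive (u t) y (e_ i)) x (e_ i)) /\
  {within [set p : R * V | (~` K) p.2],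
     continuous (fun p => derive1 (fun s => u s p.2) p.1)} /\
  (forall i, {within [set p : R * V | (~` K) p.2],
     continuous (fun p => derive (fun y => derive (u p.1) y (e_ i)) p.2 (e_ i))}) /\
  (forall t x, (~` K) x ->
     derive1 (fun s => u s x) t =
     \sum_(i < n.+2) derive (fun y => derive (u t) y (e_ i)) x (e_ i) + f (u t x)) /\
  (forall t x, g x = 0 ->
     (fun h => (u t (x + h *: grad g x) - u t x) / h) @ 0^'+ --> 0) /\
  (forall t x, (~` K) x -> 0 < u t x < 1).

Definition front_at_minus_infty (c : R) (phi : R -> R) (K : set V) (u : R -> V -> R) : Prop :=
  forall eps : R, 0 < eps -> exists T : R, forall t x, t <= T -> (~` K) x ->
    `|u t x - phi (x1 x - c * t)| <= eps.

Definition propagation (K : set V) (v : V -> R) : Prop :=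
  forall eps : R, 0 < eps -> exists A : R, forall x, (~` K) x -> A <= x1 x ->
    `|v x - 1| <= eps.

End Defs.

(* Main.v *)
(** Fix the direction x_1 and let a be the abscissa of directional convexity.  A subsolution is
    sought as W = psi(zeta), zeta(t,x) = |x_1 - a| + mu g(x) - theta |y - y_0|^2 + sigma t + const,
    where psi is increasing and psi'' + f(psi) >= kappa > 0; the kink of |x_1 - a| is convex, and
    directional convexity says that |x_1 - a| does not decrease along the inward normal on the
    boundary, the term mu g making the normal derivative strictly positive.  Instead of
    constructing psi, one compares Th(u) with zeta, where Th = psi^-1 is the primitive of
    (2 H)^(-1/2) and H' + f >= kappa; H is tiny on [1 - 2e, 1 - e], so that Th gains there as much
    as wanted, which is what the comparison over a wide slab |x_1 - a| <= A requires.  All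
    comparisons take place on compact sets and are decided at the first contact time, so that
    neither regularity nor an equation is needed for the limit v.
    The lateral values u >= 1 - e come, on the left, from the front at time -oo and static radial
    bumps, and on the right from propagation: pointwise convergence is locally uniform there by an
    interior Lipschitz bound on u(t, .), proved by doubling the variables.  When t increases,
    zeta sweeps the slab and u(t, x) > 1 - 2e follows. *)
Require Import Defs.
From mathcomp Require Import all_boot all_order all_algebra.
From mathcomp Require Import all_classical all_reals all_analysis.
From mathcomp Require Import ring lra.
Import Order.TTheory GRing.Theory Num.Theory numFieldNormedType.Exports.
Local Open Scope classical_set_scope.
Local Open Scope ring_scope.

(** * A one-dimensional profile *)

(** For [w = Th(u)], the relation [q' = - h q^3] turns the equation into w_t = Lap w + q (f + h
    |grad w|^2). Along a barrier of slope close to 1 the bracket is close to [h + f >= kap], so any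
    curvature and speed well below [q0 * kap] can be afforded. Positivity of the integral of f is
    what keeps H, the integral of a truncated f - kap from s to 1 plus a small constant [eta],
    positive down to s = 0. The obstacle is the order of the choices. The gain of Th on
    [1 - 2e, 1 - e] must exceed the height of the barrier, while Th, and with it the height E to be
    swept, depends on that gain. Hence [md], [kap], [Z], [q0], [Ch] are fixed before the gain is
    prescribed, and only [eta] adapts to it. The lateral term theta |y - y_0|^2 with theta = E / L^2
    has slope at most of order E / L, so it becomes harmless when L is chosen last. For the static
    bumps the slope vanishes at the centre, where a bound on h + f alone says too little about f.
    There [Z] decides: a value of Th above [Z] forces u >= md, and f >= kap holds between md and 1 -
    e. *)

Lemma continuous_antiderivative {R : realType} (F : R -> R) : continuous F ->
  exists G : R -> R, forall x : R, -1 < x < 2 -> is_derive x 1 G (F x).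
Proof.
move=> cF.
(* The window (-1, 2) surrounds [0, 1], so that two-sided derivatives exist at 0 and 1 too, values
   that u is not prevented from taking on the boundary of the wall. *)
exists (fun x => \int[lebesgue_measure]_(t in `[(-1 : R), x]) F t)%R => x /andP[x1 x2].
have FI : (@lebesgue_measure R).-integrable `[(-1 : R), 2] (EFin \o F).
  apply: continuous_compact_integrable; first exact: segment_compact.
  by apply: continuous_subspaceT => y; exact: cF.
have [dG eG] := continuous_FTC1_closed x2 FI x1 (cF x).
split; first exact: dG.
by rewrite -derive1E; exact: eG.
Qed.

Lemma is_derive_cts {R : realType} (G : R -> R) (x g : R) :
  is_derive x 1 G g -> {for x, continuous G}.
Proof. by move=> [dG _]; apply: differentiable_continuous; apply/derivable1_diffP. Qed.

Lemma is_derive_itv_cts {R : realType} (G g : R -> R) a b :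
  (forall x : R, a <= x <= b -> is_derive x 1 G (g x)) -> {within `[a, b], continuous G}.
Proof.
move=> dG; apply: continuous_subspace_itv => x; rewrite in_itv /= => xab.
exact: is_derive_cts (dG x xab).
Qed.

Lemma derive_le_incr {R : realType} (G g : R -> R) a b m : a <= b ->
  (forall x : R, a <= x <= b -> is_derive x 1 G (g x)) ->
  (forall x, a < x < b -> g x <= m) -> G b - G a <= m * (b - a).
Proof.
rewrite le_eqVlt => /predU1P[-> _ _|ab dG gm]; first by rewrite !subrr mulr0.
have [c|//|c cab ->] := @MVT R G g a b ab.
- rewrite in_itv /= => /andP[ac cb]; apply: dG; lra.
- exact: is_derive_itv_cts dG.
- rewrite ler_wpM2r ?subr_ge0 ?(ltW ab)//; apply: gm.
  by move: cab; rewrite in_itv.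
Qed.

Lemma derive_ge_incr {R : realType} (G g : R -> R) a b m : a <= b ->
  (forall x : R, a <= x <= b -> is_derive x 1 G (g x)) ->
  (forall x, a < x < b -> m <= g x) -> m * (b - a) <= G b - G a.
Proof.
move=> ab dG gm.
have := @derive_le_incr R (fun x => - G x) (fun x => - g x) a b (- m) ab.
move=> H; have : - G b - - G a <= - m * (b - a); last by lra.
apply: H => [x xab|x xab]; first by apply: is_deriveN; exact: dG.
by rewrite lerN2; exact: gm.
Qed.

Lemma continuous_clamp {R : realType} : continuous (fun s : R => Num.max 0 (Num.min 1 s)).
Proof.
move=> x; apply: (@continuous_max R R (fun=> 0) (fun s => Num.min 1 s)).
  exact: cst_continuous.
apply: (@continuous_min R R (fun=> 1) id); first exact: cst_continuous.
by move=> ?; exact: cvg_id.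
Qed.

Lemma clamp_itv {R : realType} (x : R) : 0 <= Num.max 0 (Num.min 1 x) <= 1.
Proof. by rewrite le_max lexx /= ge_max ler01 /= ge_min lexx. Qed.

(* q = (2 H)^(-1/2) and h = H' for the H of the header; Th is used on [0, 1] only. *)
Definition wave_profile {R : realType} (f Th q h : R -> R) (b kap q0 Ch : R) : Prop :=
  [/\ (forall s : R, -1 < s < 2 -> is_derive s 1 Th (q s)), forall s, q0 <= q s, Th 0 = 0
    & forall s : R, 0 < s <= b ->
      [/\ is_derive s 1 q (- (h s * q s ^+ 3)), `|h s| <= Ch & kap <= h s + f s]].

(** [P] is a primitive of [p = (f - kap) * cl], where the cut-off [cl] is 1 up to 1 - 3e and 0 from
    1 - 2e on. The flat piece near 1 leaves room for an arbitrarily small constant to be added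
    later, and the lower bound on [0, md] is what survives of the positive integral of f after
    truncating and subtracting kap. *)
Lemma bistable_reduced_primitive {R : realType} (f : R -> R) (alpha : R) : bistable f alpha ->
  exists2 e0 : R, 0 < e0 & forall e : R, 0 < e < e0 ->
  4 * e < 1 /\ exists (md kap d Ch : R) (P p : R -> R),
  [/\ [/\ 0 < md < 1, 0 < kap, 0 < d & 0 < Ch],
      forall s : R, md <= s <= 1 - e -> kap <= f s,
      forall s : R, 0 < s <= 1 - e -> kap <= f s - p s
    & [/\ forall s : R, -1 < s < 2 -> is_derive s 1 P (p s),
          forall s : R, 0 <= s <= 1 -> `|p s| <= Ch /\ 0 <= P 1 - P s,
          forall s : R, 0 <= s <= md -> d / 2 <= P 1 - P s
        & forall s : R, 1 - 2 * e <= s <= 1 -> P 1 - P s = 0]].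
Proof.
move=> [/andP[a0 a1]] [df] [cf'] [f0] [fa] [f1] [_] [_] [_] [fneg] [fpos] intf.
have cf : continuous f.
  by move=> x; apply: differentiable_continuous; apply/derivable1_diffP; exact: df.
have [Q dQ] := @continuous_antiderivative R f cf.
have Q10 : 0 < Q 1 - Q 0.
  have dQ' (x : R) : 0 <= x <= 1 -> is_derive x 1 Q (f x).
    by move=> x01; apply: dQ; lra.
  have := @continuous_FTC2 R f Q 0 1 ltr01.
  move=> FTC; rewrite FTC -?EFinB ?lte_fin// in intf.
  - by apply: continuous_subspaceT => y; exact: cf.
  - split.
    + by move=> x; rewrite in_itv /= => x01; case: (dQ' x _) => //; lra.
    + apply: cvg_at_right_filter; apply: (@is_derive_cts R Q 0 (f 0)).
      by apply: dQ'; lra.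
    + apply: cvg_at_left_filter; apply: (@is_derive_cts R Q 1 (f 1)).
      by apply: dQ'; lra.
  - move=> x; rewrite in_itv /= => x01; rewrite derive1E.
    by case: (dQ' x) => //; lra.
have [F F0 fF] : exists2 F : R, 0 < F & forall s : R, 0 <= s <= 1 -> `|f s| <= F.
  have cnf : {within `[(0 : R), 1], continuous (fun s => `|f s|)}.
    by apply: continuous_subspaceT => y; apply: cvg_norm; exact: cf.
  have [c _ cM] := EVT_max ler01 cnf.
  exists (`|f c| + 1); first by have := normr_ge0 (f c); lra.
  by move=> s s01; have := cM s; rewrite in_itv /= => /(_ s01); lra.
set D := Q 1 - Q 0 in Q10.
(* The first bound places the midpoint of alpha and 1, taken as [md], below 1 - 4e. The second makes
   the loss from truncating f on [1 - 3e, 1], at most 3eF, smaller than D / 2. *)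
set e0 := Num.min ((1 - alpha) / 8) (D / (6 * F)).
have De0 : 0 < D / (6 * F) by rewrite divr_gt0 // mulr_gt0.
exists e0; first by rewrite lt_min De0 andbT; lra.
move=> e /andP[e_gt0]; rewrite lt_min => /andP[ea eD].
have eFD : 6 * F * e < D by rewrite -ltr_pdivlMl ?mulr_gt0// mulrC.
pose cl := fun s : R => Num.max 0 (Num.min 1 ((1 - 2 * e - s) / e)).
have ccl : continuous cl.
  move=> s.
  apply: (@continuous_comp R R R (fun s => (1 - 2 * e - s) / e)
     (fun s : R => Num.max 0 (Num.min 1 s))); last exact: continuous_clamp.
  apply: cvgM; last exact: cvg_cst.
  by apply: cvgB; [exact: cvg_cst|exact: cvg_id].
have cl01 (s : R) : 0 <= cl s <= 1.
  exact: clamp_itv.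
have cl1 (s : R) : s <= 1 - 3 * e -> cl s = 1.
  move=> se; rewrite /cl min_l ?max_r//.
  by rewrite ler_pdivlMr//; lra.
have cl0 (s : R) : 1 - 2 * e <= s -> cl s = 0.
  move=> se; have h : (1 - 2 * e - s) / e <= 0 by rewrite ler_pdivrMr//; lra.
  by rewrite /cl min_r ?max_l//; lra.
clearbody cl.
have [md mdb] : exists md, alpha < md < 1 - 4 * e.
  by exists ((1 + alpha) / 2); clear -a1 ea; lra.
have /andP[amd md4] := mdb.
have fcl (s : R) : alpha <= s <= 1 -> 0 <= f s.
  move=> /andP[]; rewrite !le_eqVlt => /predU1P[<-|h1]; first by rewrite fa eqxx.
  by move=> /predU1P[->|h2]; rewrite ?f1 ?eqxx// fpos ?orbT// h1.
have fcln (s : R) : 0 <= s <= alpha -> f s <= 0.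
  move=> /andP[]; rewrite !le_eqVlt => /predU1P[<-|h1]; first by rewrite f0 eqxx.
  by move=> /predU1P[->|h2]; rewrite ?fa ?eqxx// fneg ?orbT// h1.
have [m0 m0_gt0 fm0] : exists2 m0 : R, 0 < m0 & forall s : R, md <= s <= 1 - e -> m0 <= f s.
  have cfs : {within `[md, 1 - e], continuous f}.
    by apply: continuous_subspaceT => y; exact: cf.
  have mde : md <= 1 - e by clear -md4 e_gt0; lra.
  have [c cm cM] := EVT_min mde cfs.
  exists (f c).
    by apply: fpos; move: cm; rewrite in_itv /= => h; clear -h amd e_gt0; lra.
  by move=> s s01; apply: cM; rewrite in_itv.
have cfc : continuous (fun s => f s * cl s).
  by move=> s; apply: cvgM; [exact: cf|exact: ccl].
have [Q1 dQ1] := @continuous_antiderivative R _ cfc.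
have [B dB] := @continuous_antiderivative R _ ccl.
have Q1D : D / 2 <= Q1 1 - Q1 0.
  pose G x := Q x - Q1 x.
  have dd (x : R) : 0 <= x <= 1 -> is_derive x 1 G (f x - f x * cl x).
    by move=> x01; apply: is_deriveB; [apply: dQ|apply: dQ1]; lra.
  have h1 : G (1 - 3 * e) - G 0 <= 0 * (1 - 3 * e - 0).
    apply: (@derive_le_incr R G (fun x => f x - f x * cl x)) => [|x hx|x hx]; first by lra.
      by apply: dd; lra.
    by rewrite cl1 ?mulr1 ?subrr//; lra.
  have h2 : G 1 - G (1 - 3 * e) <= F * (1 - (1 - 3 * e)).
    apply: (@derive_le_incr R G (fun x => f x - f x * cl x)) => [|x hx|x hx]; first by lra.
      by apply: dd; lra.
    have c01 := cl01 x.
    have x0 : 0 <= f x by apply: fcl; lra.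
    have : `|f x| <= F by apply: fF; lra.
    have : f x * cl x >= 0 by rewrite mulr_ge0//; lra.
    by rewrite ger0_norm//; lra.
  by rewrite /G /D in h1 h2 eFD *; clear -h1 h2 eFD; lra.
have Q1incr (a b : R) : alpha <= a -> a <= b -> b <= 1 -> 0 <= Q1 b - Q1 a.
  move=> aa ab b1; have := @derive_ge_incr R Q1 (fun s => f s * cl s) a b 0 ab.
  rewrite mul0r; apply=> x hx; first by apply: dQ1; clear -hx aa b1 a0; lra.
  by rewrite mulr_ge0//; [apply: fcl; clear -hx aa b1; lra|by case/andP: (cl01 x)].
have Q1md : m0 * e <= Q1 1 - Q1 md.
  have : m0 * (1 - 3 * e - md) <= Q1 (1 - 3 * e) - Q1 md.
    apply: (@derive_ge_incr R Q1 (fun s => f s * cl s)) => [|x hx|x hx].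
    - by clear -md4 e_gt0; lra.
    - by apply: dQ1; clear -hx amd a0 e_gt0; lra.
    - by rewrite cl1 ?mulr1 ?fm0//; clear -hx e_gt0; lra.
  have me : m0 * e <= m0 * (1 - 3 * e - md) by rewrite ler_pM2l//; clear -md4; lra.
  have := Q1incr (1 - 3 * e) 1 ltac:(clear -md4 amd e_gt0; lra) ltac:(clear -e_gt0; lra) (lexx _).
  by clear -me; lra.
set d := Num.min (m0 * e) (D / 2).
have d_gt0 : 0 < d by rewrite lt_min mulr_gt0//= divr_gt0.
have dD : d <= D / 2 by rewrite ge_min lexx orbT.
have dm : d <= m0 * e by rewrite ge_min lexx.
(* Left of alpha, f <= 0 makes Q1 s at most Q1 0, and the total integral decides. Right of alpha, Q1
   increases, and the piece from md to 1 decides. *)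
have Q1d (s : R) : 0 <= s <= md -> d <= Q1 1 - Q1 s.
  move=> hs; have [sa|sa] := leP alpha s.
    have := Q1incr s md sa ltac:(by case/andP: hs) ltac:(clear -md4 e_gt0; lra).
    by clear -dm Q1md; lra.
  suff : Q1 s - Q1 0 <= 0 by clear -dD Q1D; lra.
  have := @derive_le_incr R Q1 (fun s => f s * cl s) 0 s 0.
  rewrite mul0r; apply; first by case/andP: hs.
    by move=> x hx; apply: dQ1; clear -hx hs sa a1; lra.
  by move=> x hx; rewrite mulr_le0_ge0//; [apply: fcln; clear -hx sa; lra|case/andP: (cl01 x)].
(* The bound [m0] gives kap <= f on [md, 1 - e]; the bound [d / 2] lets the subtraction of
   [kap * B], whose increments on [0, 1] are at most kap, cost half of d only. *)
pose kap := Num.min m0 (d / 2).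
have kap_gt0 : 0 < kap by rewrite lt_min m0_gt0/= divr_gt0.
have kapm : kap <= m0 by rewrite ge_min lexx.
have kapd : kap <= d / 2 by rewrite ge_min lexx orbT.
clearbody d kap.
have mdb' : 0 < md < 1 by clear -amd md4 a0 e_gt0; lra.
have ee : 0 < e < 1 / 4 by clear -mdb amd md4 a0 e_gt0; lra.
clear -F0 fF ee mdb' md4 cl01 cl1 cl0 fm0 dQ1 dB Q1d d_gt0 kap_gt0 kapm kapd.
pose P := fun s => Q1 s - kap * B s.
pose p := fun s => (f s - kap) * cl s.
have dP (s : R) : -1 < s < 2 -> is_derive s 1 P (p s).
  move=> hs; rewrite /P /p mulrBl; apply: is_deriveB; first exact: dQ1.
  by apply: is_deriveZ; exact: dB.
have Pmd (s : R) : 0 <= s <= md -> d / 2 <= P 1 - P s.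
  move=> hs; have := Q1d s hs; rewrite /P.
  have : B 1 - B s <= 1 * (1 - s).
    apply: (@derive_le_incr R B cl) => [|x hx|x hx]; first by clear -hs mdb'; lra.
      by apply: dB; clear -hs hx; lra.
    by case/andP: (cl01 x).
  rewrite mul1r => h1 h2.
  have : kap * (B 1 - B s) <= kap * 1 by rewrite ler_pM2l//; clear -h1 hs; lra.
  by clear -h2 kapd; lra.
have Pge (s : R) : 0 <= s <= 1 -> 0 <= P 1 - P s.
  move=> hs; have [smd|smd] := leP s md.
    by apply: le_trans (Pmd s _); [rewrite divr_ge0// ltW|rewrite smd andbT; case/andP: hs].
  have := @derive_ge_incr R P p s 1 0; rewrite mul0r; apply; first by case/andP: hs.
    by move=> x hx; apply: dP; clear -hx hs; lra.
  move=> x hx; rewrite /p; have [xe|xe] := leP x (1 - e).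
    rewrite mulr_ge0//; last by case/andP: (cl01 x).
    by rewrite subr_ge0 (le_trans kapm)// fm0//; clear -hx smd xe; lra.
  by rewrite cl0 ?mulr0//; clear -xe ee; lra.
have Pfl (s : R) : 1 - 2 * e <= s <= 1 -> P 1 - P s = 0.
  move=> hs; apply/eqP; rewrite eq_le Pge ?andbT; last by clear -hs ee; lra.
  have := @derive_le_incr R P p s 1 0; rewrite mul0r; apply; first by case/andP: hs.
    by move=> x hx; apply: dP; clear -hx hs ee; lra.
  by move=> x hx; rewrite /p cl0 ?mulr0//; clear -hx hs; lra.
have pF (s : R) : 0 <= s <= 1 -> `|p s| <= F + kap.
  move=> hs; rewrite /p normrM -[leRHS]mulr1.
  apply: ler_pM => //; last by have /andP[c0 c1] := cl01 s; rewrite ger0_norm.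
  by rewrite (le_trans (ler_normB _ _))// (ger0_norm (ltW kap_gt0)) lerD2r fF.
split; first by clear -ee; lra.
exists md, kap, d, (F + kap), P, p; split.
- by split=> //; rewrite addr_gt0.
- by move=> s hs; rewrite (le_trans kapm)// fm0.
- move=> s hs; rewrite /p; have /andP[c0 c1] := cl01 s.
  (* Where the cut-off is 1 the inequality is an equality. Beyond, it needs f >= kap, which is known
     up to 1 - e. *)
  have [se|se] := leP s (1 - 3 * e); first by rewrite cl1// mulr1 subKr.
  have fk : kap <= f s by rewrite (le_trans kapm)// fm0 //; clear -hs se md4 ee; lra.
  have : 0 <= (f s - kap) * (1 - cl s) by rewrite mulr_ge0// subr_ge0.
  by clear; lra.
- by split=> // s hs; rewrite pF ?Pge.
Qed.

(** With H = eta + (P 1 - P s) and 0 < eta <= 1, the bounds on q follow from those on P alone: eta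
    <= 1 gives [q0], and dropping eta on [0, md] gives [Z]. Thus shrinking eta increases the gain
    near 1 without touching the other constants, which is why A is quantified last. *)
Lemma bistable_wave_profile {R : realType} (f : R -> R) (alpha : R) : bistable f alpha ->
  exists2 e0 : R, 0 < e0 & forall e : R, 0 < e < e0 ->
  exists md kap Z q0 Ch : R,
  [/\ [/\ 0 < md < 1, 0 < kap, 0 < Z, 0 < q0 & 0 < Ch],
      4 * e < 1,
      forall s : R, md <= s <= 1 - e -> kap <= f s
    & forall A : R, exists Th q h : R -> R,
      [/\ wave_profile f Th q h (1 - e) kap q0 Ch, Th md <= Z
        & A <= Th (1 - e) - Th (1 - 2 * e)]].
Proof.
move=> fb; have [e0 e0_gt0 H0] := bistable_reduced_primitive f alpha fb.
exists e0 => // e he; have [e4 {H0}] := H0 e he.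
have {he} e_gt0 : 0 < e by case/andP: he.
move=> [md [kap [d [F [P [p [[md01 kap_gt0 d_gt0 F0] fmd fp [dP pFP Pmd Pfl]]]]]]]].
have pF (s : R) : 0 <= s <= 1 -> `|p s| <= F by move=> /pFP[].
have Pge (s : R) : 0 <= s <= 1 -> 0 <= P 1 - P s by move=> /pFP[].
have Ple (s : R) : 0 <= s <= 1 -> P 1 - P s <= F.
  move=> hs; have : P 1 - P s <= F * (1 - s).
    apply: (@derive_le_incr R P p) => [|x hx|x hx]; first by lra.
      by apply: dP; lra.
    by rewrite (le_trans (ler_norm _))// pF//; lra.
  move/le_trans; apply; rewrite ler_piMr ?(ltW F0)//; lra.
pose Hm := 1 + F.
have Hm_gt0 : 0 < Hm by rewrite ltr_wpDl// ltW.
exists md, kap, (Num.sqrt d)^-1, (Num.sqrt (2 * Hm))^-1, F.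
split; [split|by []|by []|] => //.
- by rewrite invr_gt0 sqrtr_gt0.
- by rewrite invr_gt0 sqrtr_gt0 mulr_gt0.
move=> A.
(* On [1 - 2e, 1] one has 2 H = 2 eta = r^2, hence q = 1 / r, and Th gains e / r >= |A| + 1 over the
   interval of length e. *)
pose r := Num.min 1 (e / (`|A| + 1)).
have A1 : 0 < `|A| + 1 by rewrite ltr_wpDl.
have r_gt0 : 0 < r by rewrite lt_min ltr01/= divr_gt0.
have r1 : r <= 1 by rewrite ge_min lexx.
have rA : r * (`|A| + 1) <= e by rewrite -ler_pdivlMr// ge_min lexx orbT.
pose eta := r ^+ 2 / 2.
have eta_gt0 : 0 < eta by rewrite divr_gt0 ?exprn_gt0.
have eta1 : eta <= 1.
  have : r ^+ 2 <= 1 by rewrite expr_le1// ltW.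
  by rewrite /eta; lra.
pose H := fun s => eta + (P 1 - P s).
have Hge (s : R) : 0 <= s <= 1 -> eta <= H s by move=> /Pge; rewrite /H; lra.
(* Clamping the argument makes q continuous and bounded below on the whole line. The formula for q'
   is asked for inside (0, 1) only, where the clamp is the identity nearby. *)
pose clp := fun s : R => Num.max 0 (Num.min 1 s).
have clp01 (s : R) : 0 <= clp s <= 1.
  exact: clamp_itv.
have clpE (s : R) : 0 <= s <= 1 -> clp s = s.
  by move=> hs; rewrite /clp min_r ?max_r; lra.
pose q := fun s => (Num.sqrt (2 * H (clp s)))^-1.
have dH (s : R) : -1 < s < 2 -> is_derive s 1 (fun s => 2 * H s) (2 * (0 + (0 - p s))).
  move=> hs; apply: is_deriveZ; apply: is_deriveD.
  by apply: is_deriveB; exact: dP.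
have H2 (s : R) : 0 < 2 * H (clp s) by have := Hge _ (clp01 s); lra.
have cq : continuous q.
  move=> s; apply: cvgV; first by rewrite gt_eqF// sqrtr_gt0.
  apply: (@continuous_comp _ _ _ (fun s => 2 * H (clp s)) Num.sqrt);
    last exact: sqrt_continuous.
  apply: (@continuous_comp _ _ _ clp (fun s => 2 * H s)); first exact: continuous_clamp.
  by apply: (@is_derive_cts R (fun s => 2 * H s) (clp s) _ (dH _ _)); have := clp01 s; lra.
have [T0 dT0] := @continuous_antiderivative R _ cq.
pose Th := fun s => T0 s - T0 0.
have dTh (s : R) : -1 < s < 2 -> is_derive s 1 Th (q s).
  by move=> hs; rewrite /Th -[q s]subr0; apply: is_deriveB; exact: dT0.
have qle (c s : R) : 0 < c -> c <= 2 * H (clp s) -> q s <= (Num.sqrt c)^-1.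
  by move=> c0 cs; rewrite lef_pV2 ?posrE ?sqrtr_gt0// ler_wsqrtr.
exists Th, q, (fun s => - p s); split; first split => //.
- move=> s; rewrite lef_pV2 ?posrE ?sqrtr_gt0//; last by rewrite mulr_gt0.
  apply: ler_wsqrtr; rewrite /H /Hm; have := Ple _ (clp01 s).
  by have := eta1; lra.
- by rewrite /Th subrr.
- move=> s hs; split.
  + have s01 : 0 <= s <= 1 by lra.
    have Hs : 0 < 2 * H s by have := H2 s; rewrite clpE.
    have /near_eq_is_derive : \forall t \near s, (Num.sqrt (2 * H t))^-1 = q t.
      have : \forall t \near s, t \in `]0, 1[%R by apply: near_in_itv; rewrite in_itv /=; lra.
      apply: filterS => t; rewrite in_itv /= => ht; rewrite /q clpE//; lra.
    apply.
    have d1 := @is_derive1_comp R Num.sqrt (fun s => 2 * H s) s _ _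
        (is_derive1_sqrt Hs) (dH s ltac:(lra)).
    have sq0 : Num.sqrt (2 * H s) != 0 by rewrite gt_eqF// sqrtr_gt0.
    have := @is_deriveV R (Num.sqrt \o (fun s => 2 * H s)) s _ 1 sq0 d1.
    move=> dd; apply: (is_derive_eq dd); rewrite /q clpE /=; last by lra.
    rewrite [LHS]/GRing.scale /=.
    by field.
  + by rewrite normrN pF//; lra.
  + by rewrite addrC fp.
- have : Th md - Th 0 <= (Num.sqrt d)^-1 * (md - 0).
    apply: (@derive_le_incr R Th q) => [|x hx|x hx]; [lra|by apply: dTh; lra|].
    apply: qle => //; rewrite clpE; last by lra.
    by have := Pmd x; rewrite /H; lra.
  rewrite subr0 {2}/Th subrr subr0 => /le_trans; apply.
  by rewrite ler_piMr ?invr_ge0 ?sqrtr_ge0//; lra.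
- have : r^-1 * ((1 - e) - (1 - 2 * e)) <= Th (1 - e) - Th (1 - 2 * e).
    apply: (@derive_ge_incr R Th q) => [|x hx|x hx]; [lra|by apply: dTh; lra|].
    rewrite /q clpE; last by lra.
    rewrite /H Pfl ?addr0; last by lra.
    rewrite /eta (_ : 2 * (r ^+ 2 / 2) = r ^+ 2); last by field.
    by rewrite sqrtr_sqr ger0_norm// ltW.
  apply: le_trans; rewrite (_ : 1 - e - _ = e); last by ring.
  rewrite mulrC ler_pdivlMr//.
  have := ler_norm A; nra.
Qed.

(** * First contact and second derivative tests *)

(** The time t is the minimum of the time coordinate over the compact set where k <= 0. A negative
    value at time t would persist, by continuity, at slightly earlier times and contradict
    minimality. *)
Lemma compact_first_zero {R : realType} {Z : topologicalType} (D : set Z) (T0 T1 : R)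
    (k : R * Z -> R) :
  compact D -> {within `[T0, T1] `*` D, continuous k} ->
  (forall z, D z -> 0 < k (T0, z)) ->
  (exists t z, [/\ T0 <= t <= T1, D z & k (t, z) <= 0]) ->
  exists t z, [/\ T0 < t <= T1, D z, k (t, z) = 0,
    forall z', D z' -> 0 <= k (t, z') &
    forall s z', T0 <= s < t -> D z' -> 0 < k (s, z')].
Proof.
move=> cD ck k0 [t1 [z1 [t1T Dz1 kz1]]].
set C := `[T0, T1] `*` D in ck.
have cC : compact C by apply: compact_setX => //; exact: segment_compact.
have ckP := (subspace_continuousP C k).1 ck.
set B := C `&` [set p | k p <= 0].
have cB : compact B.
  move=> F PF FB.
  have FC : F C by apply: filterS FB => p [].
  have [p [Cp clp]] := cC F PF FC.
  exists p; split => //; split => //=; rewrite leNgt; apply/negP => kp.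
  have np : nbhs p [set q | C q -> 0 < k q] by exact: (cvgr_gt _ (ckP p Cp) _ kp).
  have [q [[Cq kq] Hq]] := clp _ _ FB np.
  by have := Hq Cq; rewrite ltNge kq.
have B0 : B !=set0 by exists (t1, z1); split => //; split => //=; rewrite in_itv.
have cfst : {within B, continuous (fun p : R * Z => p.1)}.
  by apply: continuous_subspaceT => p; exact: cvg_fst.
have [[t z] tzB tmin] := compact_EVT_min B0 cB cfst.
move/set_mem: tzB => [[/= + Dz] kz]; rewrite in_itv /= => /andP[T0t tT1].
have kpos s z' : T0 <= s < t -> D z' -> 0 < k (s, z').
  move=> /andP[T0s st] Dz'; rewrite ltNge; apply/negP => ks.
  have /tmin /= : (s, z') \in B.
    by apply/mem_set; split => //; split => //=; rewrite in_itv /= T0s/= (le_trans (ltW st)).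
  by rewrite leNgt st.
have {T0t} T0t : T0 < t.
  rewrite lt_neqAle T0t andbT; apply/eqP => T0t'.
  by have := k0 z Dz; rewrite T0t' ltNge => /negP; apply.
have kge z' : D z' -> 0 <= k (t, z').
  move=> Dz'; rewrite leNgt; apply/negP => kn.
  have Cp : C (t, z') by split => //=; rewrite in_itv /= ltW.
  have /= [[U W] /= [nU nW] UW] : nbhs (t, z') [set q | C q -> k q < 0].
    exact: (cvgr_lt _ (ckP _ Cp) _ kn).
  have [e /= e0 eU] := (nbhs_ballP _ _).1 nU.
  pose s := Num.max T0 (t - e / 2).
  have hs : T0 <= s < t.
    by rewrite le_max lexx /= gt_max T0t /= ltrBlDr ltrDl divr_gt0.
  have Us : U s.
    apply: eU; rewrite /ball /= ger0_norm; last by case/andP: hs => _ /ltW; rewrite subr_ge0.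
    have : t - e / 2 <= s by rewrite le_max lexx orbT.
    by lra.
  have kneg : k (s, z') < 0.
    apply: (UW (s, z')); first by split => //=; exact: (nbhs_singleton nW).
    by split => //=; rewrite in_itv /=; case/andP: hs => -> /= /ltW /le_trans; apply.
  by have := kpos s z' hs Dz'; rewrite ltNge ltW.
exists t, z; split => //; first by rewrite T0t.
by apply/eqP; rewrite eq_le kge // andbT.
Qed.

Lemma is_derive_approx {R : realType} {V : normedModType R} (G : V -> R) (x v : V) (g : R) :
  is_derive x v G g -> forall eps : R, 0 < eps ->
  exists2 d : R, 0 < d & forall s : R, `|s| < d ->
    `|G (x + s *: v) - G x - g * s| <= eps * `|s|.
Proof.
move=> [dG <-] eps eps0.
have : h^-1 *: (G (h *: v + x) - G x) @[h --> 0^'] --> 'D_v G x by exact: dG.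
move=> /cvgrPdist_lt /(_ _ eps0) /nbhs_ballP [d /= d0 dH].
exists d => // s sd.
have [->|s0] := eqVneq s 0; first by rewrite scale0r addr0 subrr mulr0 subr0 normr0 mulr0.
have : `|'D_v G x - s^-1 *: (G (s *: v + x) - G x)| < eps.
  by apply: dH => //; rewrite /ball /= sub0r normrN.
rewrite /GRing.scale /= [x + _]addrC => /ltW H.
rewrite (_ : _ - _ - _ = - s * ('D_v G x - s^-1 * (G (s *: v + x) - G x))).
  by rewrite normrM normrN mulrC ler_wpM2r.
by rewrite mulNr mulrBr mulrA divff// mul1r; ring.
Qed.

Lemma is_derive1_approx {R : realType} (G : R -> R) (x g : R) :
  is_derive x 1 G g -> forall eps : R, 0 < eps ->
  exists2 d : R, 0 < d & forall s : R, `|s| < d ->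
    `|G (x + s) - G x - g * s| <= eps * `|s|.
Proof.
move=> dG eps eps0; have [d d0 H] := is_derive_approx G x 1 g dG eps eps0.
by exists d => // s /H; rewrite /GRing.scale /= mulr1.
Qed.

Lemma is_derive_along_line {R : realType} {V : normedModType R} (G : V -> R) (x v : V) (s : R) :
  derivable G (x + s *: v) v ->
  is_derive s 1 (fun r : R => G (x + r *: v)) ('D_v G (x + s *: v)).
Proof.
move=> dG.
have E : (fun h : R => h^-1 *: (G (x + (h *: 1 + s) *: v) - G (x + s *: v))) =
         (fun h => h^-1 *: (G (h *: v + (x + s *: v)) - G (x + s *: v))).
  apply/funext => h; congr (_ *: (G _ - _)).
  by rewrite scalerDl /GRing.scale /= mulr1 addrCA.
by split; [rewrite /derivable E|rewrite /derive E].
Qed.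

Lemma is_derive_along_line0 {R : realType} {V : normedModType R} (G : V -> R) (x v : V) :
  derivable G x v -> is_derive (0 : R) 1 (fun r : R => G (x + r *: v)) ('D_v G x).
Proof.
move=> dG; have x0 : x + 0 *: v = x by rewrite scale0r addr0.
by rewrite -[in X in is_derive _ _ _ X]x0; apply: is_derive_along_line; rewrite x0.
Qed.

(* If k2 + 2m < 0, then k minus the parabola would be strictly decreasing to the right of 0. *)
Lemma second_derivative_minorant {R : realType} (k k1 : R -> R) (k2 p m e : R) : 0 < e ->
  (forall s : R, `|s| < e -> is_derive s 1 k (k1 s)) -> is_derive (0 : R) 1 k1 k2 ->
  (forall s : R, `|s| < e -> k 0 + p * s - m * s ^+ 2 <= k s) ->
  k1 0 = p /\ - (2 * m) <= k2.
Proof.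
move=> e0 dk dk1 kmin.
pose K (s : R) := k s - (k 0 + p * s - m * s ^+ 2).
pose K1 (s : R) := k1 s - (p - 2 * m * s).
have dK (s : R) : `|s| < e -> is_derive s 1 K (K1 s).
  move=> se; have dks := dk s se.
  apply: is_derive_eq; rewrite /K1 /GRing.scale /=; ring.
have K0 : K 0 = 0 by rewrite /K expr2 !mulr0 subr0 addr0 subrr.
have Kge (s : R) : `|s| < e -> 0 <= K s by move=> /kmin; rewrite /K; lra.
have dK0 : is_derive (0 : R) 1 K 0.
  apply: (@derive1_at_min R K (- (e / 2)) (e / 2) 0).
  - lra.
  - move=> t; rewrite in_itv /= => /andP[t1 t2].
    by case: (dK t) => //; rewrite ltr_norml; apply/andP; split; lra.
  - by rewrite in_itv /=; apply/andP; split; lra.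
  - move=> t; rewrite in_itv /= => /andP[t1 t2]; rewrite K0; apply: Kge.
    by rewrite ltr_norml; apply/andP; split; lra.
have K10 : K1 0 = 0.
  have [_ D0] := dK0; have : is_derive (0 : R) 1 K (K1 0) by apply: dK; rewrite normr0.
  by move=> [_]; rewrite D0.
split; first by move: K10; rewrite /K1; lra.
rewrite leNgt; apply/negP => k2m.
have dK1 : is_derive (0 : R) 1 K1 (k2 + 2 * m).
  apply: is_derive_eq; rewrite /GRing.scale /=; ring.
have [d d0 Hd] := is_derive1_approx K1 0 _ dK1 (- (k2 + 2 * m) / 2) ltac:(lra).
pose s := Num.min e d / 2.
have med : 0 < Num.min e d by rewrite lt_min e0.
have s0 : 0 < s by rewrite divr_gt0.
have sm : s < Num.min e d by rewrite /s; lra.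
have /andP[se sd] : (s < e) && (s < d) by rewrite -lt_min.
have dKs (x : R) : x \in `]0, s[ -> is_derive x 1 K (K1 x).
  by rewrite in_itv /= => /andP[x0 xs]; apply: dK; rewrite ger0_norm ?(ltW x0)// (lt_trans xs).
have cKs : {within `[0, s], continuous K}.
  apply: (@is_derive_itv_cts R K K1) => x /andP[x0 xs].
  by apply: dK; rewrite ger0_norm// (le_lt_trans xs).
have [x] := MVT s0 dKs cKs.
rewrite in_itv /= => /andP[x0 xs].
have Ks0 : 0 <= K s by apply: Kge; rewrite ger0_norm// ltW.
have xd : `|x| < d by rewrite ger0_norm ?(ltW x0)// (lt_trans xs).
have := Hd x xd; rewrite add0r K10 subr0 (ger0_norm (ltW x0)) => /(le_trans (ler_norm _)) K1x.
have : 0 < s * (- K1 x) by rewrite mulr_gt0//; nra.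
by rewrite K0; lra.
Qed.

(** The test is applied to [Th \o w], whose first and second derivatives at 0 are [q(w) w'] and
    [q'(w) w'^2 + q(w) w'']. *)
Lemma second_derivative_minorant_comp {R : realType} (Th q w w1 : R -> R) (dq w2 p m e : R) :
  0 < e -> (forall s : R, `|s| < e -> is_derive s 1 w (w1 s)) ->
  is_derive (0 : R) 1 w1 w2 ->
  (forall s : R, `|s| < e -> is_derive (w s) 1 Th (q (w s))) ->
  is_derive (w 0) 1 q dq ->
  (forall s : R, `|s| < e -> Th (w 0) + p * s - m * s ^+ 2 <= Th (w s)) ->
  q (w 0) * w1 0 = p /\ - (2 * m) <= dq * w1 0 ^+ 2 + q (w 0) * w2.
Proof.
move=> e0 dw dw1 dTh dq0 H.
have w0 : is_derive (0 : R) 1 w (w1 0) by apply: dw; rewrite normr0.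
apply: (@second_derivative_minorant R (Th \o w) (fun s => q (w s) * w1 s) _ p m e e0) => //.
  by move=> s se; apply: is_derive1_comp; [exact: dTh|exact: dw].
have dqw : is_derive (0 : R) 1 (q \o w) (dq * w1 0) by exact: is_derive1_comp.
have := is_deriveM dqw dw1 => /is_derive_eq; apply.
by rewrite /GRing.scale /= expr2; ring.
Qed.

(** * Calculus along coordinate lines and bounds for the defining function *)

Lemma e_coord {R : realType} {n : nat} (i j : 'I_n.+2) : e_ R i 0 j = (j == i)%:R.
Proof. by rewrite mxE eqxx. Qed.

Lemma add_e_coord {R : realType} {n : nat} (x : 'rV[R]_n.+2) (s : R) (i j : 'I_n.+2) :
  (x + s *: e_ R i) 0 j = x 0 j + s * (j == i)%:R.
Proof. by rewrite mxE [X in _ + X]mxE e_coord. Qed.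

Lemma row_sum_e {R : realType} {n : nat} (k : 'rV[R]_n.+2) : k = \sum_j k 0 j *: e_ R j.
Proof. exact: row_sum_delta. Qed.

Lemma coord_le_norm {R : realType} {n : nat} (x : 'rV[R]_n.+2) (j : 'I_n.+2) :
  `|x 0 j| <= `|x|.
Proof.
rewrite [leRHS]mx_normrE.
exact: (@le_bigmax _ _ _ 0 (fun ij : 'I_1 * 'I_n.+2 => `|x ij.1 ij.2|) (0, j)).
Qed.

Lemma line_MVT {R : realType} {V : normedModType R} (G : V -> R) (x v : V) (s : R) :
  (forall y, derivable G y v) ->
  exists2 c : R, `|c| <= `|s| & G (x + s *: v) - G x = 'D_v G (x + c *: v) * s.
Proof.
move=> dG.
have dL (r : R) : is_derive r 1 (fun r : R => G (x + r *: v)) ('D_v G (x + r *: v)).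
  exact: is_derive_along_line.
have G0 : G x = G (x + 0 *: v) by rewrite scale0r addr0.
have [s0|s0|<-] := ltgtP 0 s; last first.
- by exists 0 => //; rewrite mulr0 G0 subrr.
- have [|c] := @MVT R _ _ s 0 s0 (fun r _ => dL r).
    by apply: (@is_derive_itv_cts R _ (fun r => 'D_v G (x + r *: v))) => r _; exact: dL.
  rewrite in_itv /= => /andP[cs c0] E; exists c.
    by rewrite !ler0_norm ?lerN2 ?ltW// (lt_trans cs).
  by rewrite G0 -opprB E sub0r mulrN opprK.
- have [|c] := @MVT R _ _ 0 s s0 (fun r _ => dL r).
    by apply: (@is_derive_itv_cts R _ (fun r => 'D_v G (x + r *: v))) => r _; exact: dL.
  rewrite in_itv /= => /andP[c0 cs] E; exists c.
    by rewrite !ger0_norm ?ltW// (lt_trans c0).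
  by rewrite G0 E subr0.
Qed.

(** The displacement is performed one coordinate at a time along the list, each leg being a mean
    value theorem on a line; partial derivatives therefore suffice. *)
Lemma partials_lipschitz {R : realType} {n : nat} (G : 'rV[R]_n.+2 -> R) (C : R) :
  (forall x i, derivable G x (e_ R i)) -> (forall x i, `|'D_(e_ R i) G x| <= C) ->
  forall (l : seq 'I_n.+2) (k : 'I_n.+2 -> R) x,
    `|G (x + \sum_(j <- l) k j *: e_ R j) - G x| <= C * \sum_(j <- l) `|k j|.
Proof.
move=> dG GC; elim=> [|i l IH] k x; first by rewrite !big_nil addr0 subrr normr0 mulr0.
rewrite !big_cons addrA.
have [c _ E] := line_MVT G x (e_ R i) (k i) (fun y => dG y i).
have := IH k (x + k i *: e_ R i); have := GC (x + c *: e_ R i) i.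
set G1 := G (x + k i *: e_ R i) in E *; set G2 := G (_ + _ + _).
move=> H1 H2; rewrite (_ : G2 - G x = (G2 - G1) + (G1 - G x)); last by ring.
rewrite (le_trans (ler_normD _ _))// addrC mulrDr lerD// E normrM.
by rewrite ler_wpM2r.
Qed.

(** Same walk along the list. After the leg k_i the remaining partial derivatives have drifted by at
    most C |k_i|. With S the length of the remaining legs, C k_i^2 + C |k_i| S + C S^2 <= C (|k_i| +
    S)^2, so the constant does not grow with the list. *)
Lemma partials_taylor {R : realType} {n : nat} (G : 'rV[R]_n.+2 -> R) (C : R) :
  (forall x i, derivable G x (e_ R i)) ->
  (forall x i j (s : R),
     `|'D_(e_ R i) G (x + s *: e_ R j) - 'D_(e_ R i) G x| <= C * `|s|) ->
  forall (l : seq 'I_n.+2) (k : 'I_n.+2 -> R) x,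
    `|G (x + \sum_(j <- l) k j *: e_ R j) - G x - \sum_(j <- l) 'D_(e_ R j) G x * k j|
      <= C * (\sum_(j <- l) `|k j|) ^+ 2.
Proof.
move=> dG GC.
have C0 : 0 <= C.
  by have := GC 0 0 0 1; rewrite normr1 mulr1; apply: le_trans.
elim=> [|i l IH] k x.
  by rewrite !big_nil addr0 !subrr normr0 expr0n mulr0.
rewrite !big_cons addrA.
have [c cs E] := line_MVT G x (e_ R i) (k i) (fun y => dG y i).
have H2 := IH k (x + k i *: e_ R i).
set y := x + k i *: e_ R i in E H2 *.
set S := \sum_(j <- l) `|k j| in H2 *.
have S0 : 0 <= S by apply: sumr_ge0.
set G2 := G (_ + _) in H2 *; set D2 := \sum_(j <- l) _ in H2; set D1 := \sum_(j <- l) _.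
have H1 : `|('D_(e_ R i) G (x + c *: e_ R i) - 'D_(e_ R i) G x) * k i| <= C * `|k i| * `|k i|.
  rewrite normrM ler_wpM2r// (le_trans (GC _ _ _ _))//.
  by rewrite ler_wpM2l.
have H3 : `|D2 - D1| <= C * `|k i| * S.
  rewrite -sumrB mulr_sumr (le_trans (ler_norm_sum _ _ _))//.
  apply: ler_sum => j _; rewrite -mulrBl normrM ler_wpM2r//.
  exact: GC.
rewrite (_ : _ - _ - _ = (G2 - G y - D2) + (D2 - D1)
   + ('D_(e_ R i) G (x + c *: e_ R i) - 'D_(e_ R i) G x) * k i); last first.
  by rewrite mulrBl -E; ring.
have := ler_normD (G2 - G y - D2 + (D2 - D1))
   (('D_(e_ R i) G (x + c *: e_ R i) - 'D_(e_ R i) G x) * k i).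
have := ler_normD (G2 - G y - D2) (D2 - D1).
have : 0 <= C * `|k i| * S by rewrite !mulr_ge0.
lra.
Qed.

Lemma finite_uniform_bound {R : realType} {I : finType} {T : Type} (F : I -> T -> R) :
  (forall i, exists C : R, forall x, `|F i x| <= C) ->
  exists2 C : R, 0 < C & forall i x, `|F i x| <= C.
Proof.
move=> /choice[c cP]; exists (1 + \sum_i `|c i|).
  by rewrite ltr_pwDl// sumr_ge0.
move=> i x; rewrite (le_trans (cP i x))// (bigD1 i)//=.
have := ler_norm (c i); have : 0 <= \sum_(j | j != i) `|c j| by apply: sumr_ge0.
lra.
Qed.

(** One constant serves for the size of g, its slope and its Taylor remainder. Continuity of g comes
    from the Lipschitz bound, since [unif_smooth] speaks of derivatives along the coordinate
    axes. *)
Lemma unif_smooth_bounds {R : realType} {n : nat} (g : 'rV[R]_n.+2 -> R) : unif_smooth g ->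
  exists2 C : R, 0 < C &
  [/\ forall x, `|g x| <= C, forall x i, `|'D_(e_ R i) g x| <= C, continuous g &
   forall (l : seq 'I_n.+2) (k : 'I_n.+2 -> R) x,
    `|g (x + \sum_(j <- l) k j *: e_ R j) - g x - \sum_(j <- l) 'D_(e_ R j) g x * k j|
      <= C * (\sum_(j <- l) `|k j|) ^+ 2].
Proof.
move=> [dg bg].
have [C0 HC0] := bg [::].
have [C1 C1p HC1] := finite_uniform_bound (fun i => dpart [:: i] g) (fun i => bg [:: i]).
have [C2 C2p HC2] := finite_uniform_bound (fun ij : 'I_n.+2 * 'I_n.+2 => dpart [:: ij.1; ij.2] g)
   (fun ij => bg [:: ij.1; ij.2]).
have dg0 x i : derivable g x (e_ R i) := dg [::] x i.
have lip := partials_lipschitz g C1 dg0 (fun x i => HC1 i x).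
pose C := `|C0| + C1 + C2.
have C1C : C1 <= C by rewrite /C; have := normr_ge0 C0; lra.
have C2C : C2 <= C by rewrite /C; have := normr_ge0 C0; lra.
have C0C : C0 <= C by rewrite /C; have := ler_norm C0; lra.
exists C; first lra.
split.
- by move=> x; rewrite (le_trans (HC0 x)).
- by move=> x i; rewrite (le_trans (HC1 i x)).
- move=> x; apply/(@cvgrPdist_le _ _ _ _ (nbhs_filter x)) => eps eps0.
  pose K := C1 * n.+2%:R + 1.
  have K0 : 0 < K by rewrite ltr_wpDl// mulr_ge0// ltW.
  apply/nbhs_ballP; exists (eps / K) => /=; first exact: divr_gt0.
  move=> y; rewrite -ball_normE /= => xy.
  rewrite distrC (_ : y = x + (y - x)); last by rewrite addrC subrK.
  rewrite {1}(row_sum_e (y - x)) (le_trans (lip _ _ _))//.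
  have : \sum_j `|(y - x) 0 j| <= n.+2%:R * `|x - y|.
    rewrite -[X in X%:R]card_ord mulr_natl -sumr_const.
    by apply: ler_sum => j _; rewrite distrC coord_le_norm.
  move=> /(ler_wpM2l (ltW C1p)) /le_trans; apply.
  have := ltW xy; rewrite ler_pdivlMr// => H.
  by apply: le_trans H; rewrite mulrA mulrC ler_wpM2l// /K lerDl.
- have := partials_taylor g C dg0; apply => x i j s.
  have [c _ ->] := line_MVT ('D_(e_ R i) g) x (e_ R j) s (fun y => dg [:: i] y j).
  rewrite normrM ler_wpM2r// (le_trans _ C2C)//.
  exact: (HC2 (j, i)).
Qed.

(** The norm of a row vector is the maximum of its entries in absolute value, so a single partial
    derivative already reaches delta. *)
Lemma grad_sum_sqr {R : realType} {n : nat} (g : 'rV[R]_n.+2 -> R) x (delta : R) :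
  0 < delta -> delta <= `|grad g x| -> delta ^+ 2 <= \sum_i ('D_(e_ R i) g x) ^+ 2.
Proof.
move=> d0 dg.
have : mx_norm (grad g x) != 0 by rewrite gt_eqF// (lt_le_trans d0).
move=> /mx_norm_neq0[[i j] /= E].
move: dg; rewrite [leRHS]E ord1 mxE => dg.
rewrite (bigD1 j)//= -[X in _ <= X + _]real_normK ?num_real//.
have : delta ^+ 2 <= `|'D_(e_ R j) g x| ^+ 2 by rewrite lerXn2r// nnegrE ltW.
have : 0 <= \sum_(i < n.+2 | i != j) ('D_(e_ R i) g x) ^+ 2.
  by apply: sumr_ge0 => k _; exact: sqr_ge0.
lra.
Qed.

(** * The contact inequality for Th(u) *)

(** This is the equation w_t = Lap w + q (f + h |grad w|^2) of w = Th(u), read at a contact from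
    above with a test function of slope p, second derivatives -2 m_i and speed sg. Contact from the
    past bounds w_t by sg, and contact in space bounds each second derivative of w from below. *)
Lemma interior_touch {R : realType} {n : nat} (f Th q h : R -> R) (b kap q0 Ch : R)
    (u : R -> 'rV[R]_n.+2 -> R) (t : R) (x : 'rV[R]_n.+2) (p m : 'I_n.+2 -> R) (sg e : R) :
  wave_profile f Th q h b kap q0 Ch -> 0 < q0 ->
  derivable (fun s => u s x) t 1 ->
  derive1 (fun s => u s x) t = \sum_i 'D_(e_ R i) ('D_(e_ R i) (u t)) x + f (u t x) ->
  0 < u t x <= b -> 0 < e ->
  (forall i (s : R), `|s| < e -> [/\ derivable (u t) (x + s *: e_ R i) (e_ R i),
     0 < u t (x + s *: e_ R i) < 1 &
     Th (u t x) + p i * s - m i * s ^+ 2 <= Th (u t (x + s *: e_ R i))]) ->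
  (forall i, derivable ('D_(e_ R i) (u t)) x (e_ R i)) ->
  (forall s : R, t - e < s < t -> Th (u t x) + sg * (s - t) <= Th (u s x)) ->
  q (u t x) * (f (u t x) + h (u t x) * \sum_i p i ^+ 2) <= sg + 2 * \sum_i m i.
Proof.
move=> [dTh qq0 _ dq] q0p ut pde ub e0 H ddu Ht.
have [dq0 _ _] := dq _ ub.
have u1 : -1 < u t x < 2.
  have [_ u01 _] := H ord0 0 ltac:(by rewrite normr0).
  by move: u01; rewrite scale0r addr0; lra.
have qp : 0 < q (u t x) by rewrite (lt_le_trans q0p).
set U := u t x in ub dq0 u1 qp *.
have time : q U * derive1 (fun s => u s x) t <= sg.
  have dd : is_derive t 1 (Th \o (fun s => u s x)) (q U * derive1 (fun s => u s x) t).
    by apply: is_derive1_comp; [exact: dTh|rewrite derive1E; exact: derivableP].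
  rewrite leNgt; apply/negP => lt.
  set D := q U * _ in dd lt.
  have [d d0 Hd] := is_derive1_approx _ _ _ dd ((D - sg) / 2) ltac:(lra).
  pose r := Num.min e d / 2.
  have med : 0 < Num.min e d by rewrite lt_min e0.
  have r0 : 0 < r by rewrite divr_gt0.
  have rm : r < Num.min e d by rewrite /r; lra.
  have /andP[re rd] : (r < e) && (r < d) by rewrite -lt_min.
  have := Hd (- r); rewrite normrN (gtr0_norm r0) => /(_ rd) /(le_trans (ler_norm _)) /=.
  have := Ht (t - r) ltac:(apply/andP; split; lra).
  have : 0 < (D - sg) * r by rewrite mulr_gt0// subr_gt0.
  rewrite /U; lra.
(* Tangency gives q u_i = p_i, hence q' u_i^2 = - h q^3 u_i^2 = - h q p_i^2. *)
have space i : - (2 * m i) <= q U * ('D_(e_ R i) ('D_(e_ R i) (u t)) x - h U * p i ^+ 2).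
  have := @second_derivative_minorant_comp R Th q (fun s => u t (x + s *: e_ R i))
    (fun s => 'D_(e_ R i) (u t) (x + s *: e_ R i)) (- (h U * q U ^+ 3))
    ('D_(e_ R i) ('D_(e_ R i) (u t)) x) (p i) (m i) e e0.
  rewrite /= !scale0r !addr0 -/U; case.
  - by move=> s /(H i)[du _ _]; exact: is_derive_along_line.
  - exact: (is_derive_along_line0 ('D_(e_ R i) (u t)) x (e_ R i) (ddu i)).
  - by move=> s /(H i)[_ u01 _]; apply: dTh; lra.
  - by move=> s /(H i)[].
  move=> pE /le_trans; apply; rewrite -pE le_eqVlt; apply/orP; left; apply/eqP; ring.
have : \sum_i - (2 * m i) <=
    \sum_i (q U * ('D_(e_ R i) ('D_(e_ R i) (u t)) x - h U * p i ^+ 2)).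
  by apply: ler_sum => i _; exact: space.
rewrite sumrN -!mulr_sumr sumrB -mulr_sumr.
rewrite pde mulrDr in time.
rewrite mulrBr mulrDr; lra.
Qed.

(** * The state 1 on the left *)

Lemma wave_profile_incr {R : realType} (f Th q h : R -> R) (b kap q0 Ch : R) :
  wave_profile f Th q h b kap q0 Ch -> forall s s' : R, 0 <= s -> s <= s' -> s' <= 1 ->
  q0 * (s' - s) <= Th s' - Th s.
Proof.
move=> [dTh qq0 _ _] s s' s0 ss' s1; apply: (@derive_ge_incr R Th q) => // x hx.
by apply: dTh; lra.
Qed.

Lemma wave_profile_lt {R : realType} (f Th q h : R -> R) (b kap q0 Ch : R) :
  wave_profile f Th q h b kap q0 Ch -> 0 <= q0 -> forall s s' : R, 0 <= s' -> s <= 1 ->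
  Th s < Th s' -> s < s'.
Proof.
move=> wp q00 s s' s0 s1; rewrite !ltNge; apply: contra => ss'.
have := wave_profile_incr f Th q h b kap q0 Ch wp s' s s0 ss' s1.
have : 0 <= q0 * (s - s') by rewrite mulr_ge0// subr_ge0.
lra.
Qed.

Lemma continuous_coord {R : realType} {n : nat} (j : 'I_n.+2) :
  continuous (fun x : 'rV[R]_n.+2 => x 0 j).
Proof. exact: coord_continuous. Qed.

Lemma continuous_sum_sqr {R : realType} {n : nat} (P : pred 'I_n.+2) (c : 'rV[R]_n.+2) :
  continuous (fun x : 'rV[R]_n.+2 => \sum_(j | P j) (x 0 j - c 0 j) ^+ 2).
Proof.
apply: continuous_big => [|j _ x]; first exact: add_continuous.
have cj : (x' 0 j - c 0 j) @[x' --> x] --> x 0 j - c 0 j.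
  by apply: cvgB; [exact: continuous_coord|exact: cvg_cst].
by apply: (@continuous_comp _ _ _ (fun x' : 'rV[R]_n.+2 => x' 0 j - c 0 j) (fun y => y ^+ 2));
  [exact: cj|exact: exprn_continuous].
Qed.

Lemma within_continuous_transform {R : realType} {n : nat} (f Th q : R -> R)
    (K : set 'rV[R]_n.+2) (g : 'rV[R]_n.+2 -> R) (u : R -> 'rV[R]_n.+2 -> R)
    (I : set R) (D : set 'rV[R]_n.+2) :
  entire_solution f K g u -> D `<=` closure (~` K) ->
  (forall t x, D x -> 0 <= u t x <= 1) ->
  (forall s : R, -1 < s < 2 -> is_derive s 1 Th (q s)) ->
  {within I `*` D, continuous (fun p : R * 'rV[R]_n.+2 => Th (u p.1 p.2))}.
Proof.
move=> [cu _] DK u01 dTh; apply: (@within_continuous_comp _ _ _ _ (fun p => u p.1 p.2) Th).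
  move=> y /set_mem[[t x] /= [_ Dx] <-].
  by apply: (is_derive_cts Th _ (q (u t x))); apply: dTh; have := u01 t x Dx; lra.
by apply: continuous_subspaceW cu => -[t x] [_ /= /DK].
Qed.

Lemma within_continuousB {R : realType} {T : topologicalType} (A : set T) (a b : T -> R) :
  {within A, continuous a} -> {within A, continuous b} ->
  {within A, continuous (fun x => a x - b x)}.
Proof.
move=> /subspace_continuousP ca /subspace_continuousP cb.
by apply/subspace_continuousP => x Ax; apply: cvgB; [exact: ca|exact: cb].
Qed.

Lemma compact_box {R : realType} {n : nat} (a b : 'I_n.+2 -> R) :
  compact [set x : 'rV[R]_n.+2 | forall j, a j <= x 0 j <= b j].
Proof.
have := @rV_compact R n.+2 (fun j => `[a j, b j]%classic)
   (fun j => @segment_compact R (a j) (b j)).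
congr compact; apply/seteqP; split=> x /= H j; have := H j; by rewrite ?in_itv.
Qed.

(* Bumps supported in large balls far to the left stay below u once they start below it;
   at the centre they take a value above 1 - 2e. *)
Lemma left_state {R : realType} {n : nat} (f : R -> R) (alpha c : R) (phi : R -> R)
    (K : set 'rV[R]_n.+2) (g : 'rV[R]_n.+2 -> R) (M : R) (u : R -> 'rV[R]_n.+2 -> R) :
  bistable f alpha -> phi x @[x --> -oo] --> (1 : R) ->
  K `<=` [set x | 0 <= x1 x <= M] ->
  entire_solution f K g u -> front_at_minus_infty c phi K u ->
  exists2 e0 : R, 0 < e0 & forall e : R, 0 < e < e0 -> exists A T : R,
    forall (t : R) (x : 'rV[R]_n.+2), T <= t ->
    x 0 0 <= - A -> 1 - 2 * e < u t x.
Proof.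
move=> bf phi1 KM sol front.
have [e0 e0_gt0 He0] := bistable_wave_profile f alpha bf.
exists e0 => // e he.
have [md [kap [Z [q0 [Ch [[md01 kap0 Z0 q00 Ch0] e4 fmd HA]]]]]] := He0 e he.
have {he} e_gt0 : 0 < e by case/andP: he.
have [N NE] : exists N : R, N = n.+2%:R by exists n.+2%:R.
have N0 : 0 < N by rewrite NE ltr0n.
have n1 : 0 <= 4 * N / (q0 * kap) by rewrite divr_ge0// ?mulr_ge0// ltW.
have n2 : 0 <= 4 * Ch * Z / kap by rewrite divr_ge0// ?mulr_ge0// ltW.
(* The first term makes the curvature N / L of the bump smaller than q0 kap / 2, and the second
   controls h where u < md. Both involve only constants fixed before Th. *)
have [L0 L0E] : exists L0, L0 = 4 * N / (q0 * kap) + 4 * Ch * Z / kap + 1.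
  by exists (4 * N / (q0 * kap) + 4 * Ch * Z / kap + 1).
have L00 : 1 <= L0 by rewrite L0E; clear -n1 n2; lra.
(* The top L / 2 = Th(1 - 2e) + L0 of the bump lies above Th(1 - 2e) but below Th(1 - e). So u < 1 -
   e at any contact, where the inequalities of [wave_profile] apply. *)
have [Th [q [h [wp Thmd Thd]]]] := HA (L0 + 1).
have [dTh qq0 Th0 _] := wp.
have Thlt (s s' : R) : 0 <= s' -> s <= 1 -> Th s < Th s' -> s < s'.
  exact: (wave_profile_lt f Th q h _ kap q0 Ch wp (ltW q00)).
have Thle (s s' : R) : 0 <= s -> s <= s' -> s' <= 1 -> q0 * (s' - s) <= Th s' - Th s.
  exact: (wave_profile_incr f Th q h _ kap q0 Ch wp).
have Thb0 : 0 <= Th (1 - 2 * e).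
  have := Thle 0 (1 - 2 * e) (lexx _) ltac:(clear -e4 e_gt0; lra) ltac:(clear -e_gt0; lra).
  by rewrite Th0 !subr0; apply: le_trans; rewrite mulr_ge0 ?(ltW q00)//; clear -e4 e_gt0; lra.
have [L LE] : exists L, L = 2 * (Th (1 - 2 * e) + L0) by exists (2 * (Th (1 - 2 * e) + L0)).
have L2 : 2 * L0 <= L by rewrite LE; clear -Thb0; lra.
have L_gt0 : 0 < L by clear -L00 L2; lra.
have Lq : 2 * N < q0 * kap * L.
  have : 4 * N / (q0 * kap) <= L by rewrite L0E in L2; clear -L2 n1 n2; lra.
  by rewrite ler_pdivrMr ?mulr_gt0//; clear -N0; lra.
have LZ : 4 * Ch * Z <= kap * L.
  have : 4 * Ch * Z / kap <= L by rewrite L0E in L2; clear -L2 n1 n2; lra.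
  by rewrite ler_pdivrMr// [kap * L]mulrC.
have [B HB] : exists B : R, forall z : R, z < B -> 1 - e / 2 <= phi z.
  have := (@cvgrPdist_le _ _ _ _ _ _ _).1 phi1 (e / 2) ltac:(clear -e_gt0; lra).
  move=> [B [_ HB]]; exists B => z zB; have := HB z zB; rewrite ler_norml; clear; lra.
have [T HT] := front (e / 2) ltac:(clear -e_gt0; lra).
have BT0 := normr_ge0 (B + c * T).
(* A ball of radius L centred beyond this abscissa avoids the wall, and on it x_1 - cT < B, so u >=
   1 - e at time T. Neither bound depends on the centre or on the final time. *)
exists (L + 1 + `|B + c * T| + 1), T => t1 x0 Tt1 x0A; rewrite ltNge; apply/negP => ut1.
pose r2 (x : 'rV[R]_n.+2) := \sum_j (x 0 j - x0 0 j) ^+ 2.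
pose D := [set x | r2 x <= L ^+ 2].
have coordD (x : 'rV[R]_n.+2) j : D x -> `|x 0 j - x0 0 j| <= L.
  move=> Dx; have : (x 0 j - x0 0 j) ^+ 2 <= L ^+ 2.
    apply: le_trans Dx; rewrite /r2 (bigD1 j)//= lerDl sumr_ge0// => k _; exact: sqr_ge0.
  by rewrite -[X in X <= _]real_normK ?num_real// ler_sqr// nnegrE ltW.
have DO (x : 'rV[R]_n.+2) : D x -> x 0 0 <= - 2 - `|B + c * T|.
  move=> /(coordD x 0); rewrite ler_norml; move: `|B + c * T| x0A => y; clear; lra.
have OK (x : 'rV[R]_n.+2) : x 0 0 < 0 -> (~` K) x.
  by move=> xn /KM /andP[]; rewrite /x1 leNgt xn.
have DK (x : 'rV[R]_n.+2) : D x -> (~` K) x.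
  by move=> /DO Dx; apply: OK; clear -Dx BT0; lra.
have [_ [du [_ [_ [pde [_ u01]]]]]] := sol.
have u01' (t : R) (x : 'rV[R]_n.+2) : D x -> 0 <= u t x <= 1 by move=> /DK /(u01 t x) /andP[h1 h2]; rewrite !ltW.
have cD : compact D.
  apply: (@subclosed_compact _ D [set x : 'rV[R]_n.+2 | forall j, x0 0 j - L <= x 0 j <= x0 0 j + L]).
  - apply: (@closed_comp _ _ r2 [set y | y <= L ^+ 2]); last exact: closed_le.
    by move=> x _; exact: continuous_sum_sqr.
  - exact: compact_box.
  - by move=> x Dx j; have := coordD x j Dx; rewrite ler_norml; clear; lra.
(* The height is L / 2 at the centre and 0 on the sphere, the slope is |x - x0| / L <= 1, and all
   pure second derivatives equal -1 / L. *)
pose zeta (x : 'rV[R]_n.+2) := L / 2 - r2 x / (2 * L).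
pose k (p : R * 'rV[R]_n.+2) := Th (u p.1 p.2) - zeta p.2.
have r20 (x : 'rV[R]_n.+2) : 0 <= r2 x by apply: sumr_ge0 => j _; exact: sqr_ge0.
have zle (x : 'rV[R]_n.+2) : zeta x <= L / 2 by rewrite /zeta lerBlDr lerDl divr_ge0// mulr_ge0// ltW.
have czeta : continuous zeta.
  move=> x; apply: (@continuous_comp _ _ _ r2 (fun y : R => L / 2 - y / (2 * L))).
    exact: continuous_sum_sqr.
  by apply: cvgB; [exact: cvg_cst|apply: cvgM; [exact: cvg_id|exact: cvg_cst]].
have ck : {within `[T, t1] `*` D, continuous k}.
  apply: within_continuousB.
    apply: (within_continuous_transform f Th q K g) => // x /DK Kx.
    by move=> W nW; exists x; split => //; exact: nbhs_singleton.
  apply: continuous_subspaceT => p.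
  apply: (@continuous_comp _ _ _ snd zeta); first exact: cvg_snd.
  exact: czeta.
have k0 (x : 'rV[R]_n.+2) : D x -> 0 < k (T, x).
  move=> Dx; rewrite /k /= subr_gt0.
  have uT : 1 - e <= u T x.
    have := HT T x (lexx _) (DK x Dx); have := HB (x1 x - c * T).
    have := DO x Dx; rewrite /x1 => h1 h2; rewrite ler_norml => h3.
    have h4 : x 0 0 - c * T < B.
      by have := ler_norm (- (B + c * T)); rewrite normrN; clear -h1; lra.
    by have := h2 h4; clear -h3; lra.
  have /andP[_ uT1] := u01' T x Dx.
  have := Thle (1 - e) (u T x) ltac:(clear -e4 e_gt0; lra) uT uT1.
  have : 0 <= q0 * (u T x - (1 - e)) by rewrite mulr_ge0 ?subr_ge0// ltW.
  by have := zle x; rewrite LE; clear -Thd; lra.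
have Dx0 : D x0 by rewrite /D /= /r2 big1 ?sqr_ge0// => j _; rewrite subrr expr0n.
case: (compact_first_zero D T t1 k cD ck k0).
  exists t1, x0; split => //; first by rewrite Tt1 lexx.
  rewrite /k /zeta /r2 /= big1 ?mul0r ?subr0; last by move=> j _; rewrite subrr expr0n.
  have /andP[ut0 _] := u01' t1 x0 Dx0.
  have := Thle (u t1 x0) (1 - 2 * e) ut0 ut1 ltac:(clear -e_gt0; lra).
  have : 0 <= q0 * (1 - 2 * e - u t1 x0) by rewrite mulr_ge0 ?subr_ge0// ltW.
  by rewrite LE; clear -L00; lra.
move=> t [z [/andP[Tt tt1] Dz kz kge kpos]].
have uz := u01 t z (DK z Dz).
have kzE : Th (u t z) = zeta z by apply/eqP; rewrite -subr_eq0; exact/eqP.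
(* On the sphere the bump vanishes while Th(u) > 0, so no contact occurs there. *)
have r2L : r2 z < L ^+ 2.
  rewrite lt_neqAle; apply/andP; split; last exact: Dz.
  apply/eqP => E.
  have : zeta z = 0 by rewrite /zeta E; field; rewrite gt_eqF.
  have /andP[uz0 uz1] := uz.
  have := Thle 0 (u t z) (lexx _) (ltW uz0) (ltW uz1).
  rewrite kzE Th0 !subr0 => h1 h2.
  have : 0 < q0 * u t z by rewrite mulr_gt0.
  by rewrite h2 in h1; rewrite ltNge h1.
have ue : u t z < 1 - e.
  have /andP[uz0 uz1] := uz.
  apply: Thlt; [clear -e4 e_gt0; lra|exact: ltW|]; rewrite kzE (le_lt_trans (zle z))//.
  by rewrite LE; clear -Thd; lra.
(* A coordinate step s with |s| <= 1 changes r2 by at most (2 L + 1) |s|, so these steps stay in the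
   ball. *)
pose e1 := Num.min (1 / 2) ((L ^+ 2 - r2 z) / (2 * L + 1)).
have d1 : 0 < (L ^+ 2 - r2 z) / (2 * L + 1) by rewrite divr_gt0 ?subr_gt0// ltr_wpDl// mulr_ge0// ltW.
have e10 : 0 < e1 by rewrite lt_min d1 andbT divr_gt0.
have move1 i (s : R) : r2 (z + s *: e_ R i) = r2 z + 2 * (z 0 i - x0 0 i) * s + s ^+ 2.
  rewrite /r2 (bigD1 i)//= [in RHS](bigD1 i)//= add_e_coord eqxx mulr1.
  rewrite (eq_bigr (fun j => (z 0 j - x0 0 j) ^+ 2)); first by ring.
  by move=> j ji; rewrite add_e_coord (negbTE ji) mulr0 addr0.
have moveD i (s : R) : `|s| < e1 -> D (z + s *: e_ R i).
  rewrite lt_min => /andP[s1 s2]; rewrite /D /= move1.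
  have := coordD z i Dz => zi.
  have h1 : `|s| * (2 * L + 1) < L ^+ 2 - r2 z by rewrite -ltr_pdivlMr// ltr_wpDl// mulr_ge0// ltW.
  have h2 : 2 * (z 0 i - x0 0 i) * s <= 2 * L * `|s|.
    rewrite (le_trans (ler_norm _))// !normrM ler_wpM2r// (ger0_norm (ler0n _ 2)).
    by rewrite ler_pM2l.
  have h3 : s ^+ 2 <= `|s| by rewrite -real_normK ?num_real// expr2 ler_piMr//; clear -s1; lra.
  by clear -h1 h2 h3; lra.
have DKi i (s : R) : `|s| < e1 -> (~` K) (z + s *: e_ R i) by move=> /(moveD i s) /DK.
have [dt dx] := du t z (DK z Dz).
have touch : q (u t z) * (f (u t z) + h (u t z) * \sum_i (- (z 0 i - x0 0 i) / L) ^+ 2)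
    <= 0 + 2 * \sum_(i < n.+2) 1 / (2 * L).
  apply: (interior_touch f Th q h _ kap q0 Ch u t z _ _ 0 (Num.min e1 (t - T)) wp q00 dt
    (pde t z (DK z Dz))).
  - by case/andP: uz => -> _ /=; exact: ltW.
  - by rewrite lt_min e10 subr_gt0.
  - move=> i s; rewrite lt_min => /andP[s1 _].
    have [_ /(_ i)[du' _]] := du t _ (DKi i s s1).
    split => //; first exact: u01 (DKi i s s1).
    have := kge _ (moveD i s s1); rewrite /k /= subr_ge0 => /(le_trans _); apply.
    rewrite /= kzE /zeta move1 le_eqVlt; apply/orP; left; apply/eqP; field.
    by rewrite gt_eqF.
  - by move=> i; case: (dx i).
  - move=> s /andP[s1 s2]; rewrite mul0r addr0 kzE.
    have sT : T <= s < t.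
      rewrite s2 andbT; have : Num.min e1 (t - T) <= t - T by rewrite ge_min lexx orbT.
      by clear -s1; lra.
    by have := kpos s z sT Dz; rewrite /k /= subr_gt0 => /ltW.

have {touch} : q (u t z) * (f (u t z) + h (u t z) * (r2 z / L ^+ 2)) <= N / L.
  apply: le_trans (le_trans touch _); rewrite le_eqVlt; apply/orP; left; apply/eqP.
    congr (_ * (_ + _ * _)); rewrite /r2 mulr_suml; apply: eq_bigr => i _.
    by field; rewrite gt_eqF.
  rewrite sumr_const card_ord -[_ *+ n.+2]mulr_natr add0r -NE.
  by field; rewrite gt_eqF.
have rhoE : zeta z = L / 2 * (1 - r2 z / L ^+ 2) by rewrite /zeta; field; rewrite gt_eqF.
have rho0 : 0 <= r2 z / L ^+ 2 by rewrite divr_ge0// exprn_ge0// ltW.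
have rho1 : r2 z / L ^+ 2 <= 1 by rewrite ler_pdivrMr ?exprn_gt0// mul1r.
have [_ hC hf] : [/\ is_derive (u t z) 1 q (- (h (u t z) * q (u t z) ^+ 3)),
    `|h (u t z)| <= Ch & kap <= h (u t z) + f (u t z)].
  by case: wp => _ _ _; apply; case/andP: uz => -> _ /=; exact: ltW.
have Umd : (md <= u t z -> kap <= f (u t z)) /\ (u t z < md -> Th (u t z) <= Z).
  split=> [h1|h1]; first by apply: fmd; rewrite h1 ltW.
  have /andP[uz0 _] := uz; have /andP[_ md1] := md01.
  have := Thle (u t z) md (ltW uz0) (ltW h1) (ltW md1).
  have : 0 <= q0 * (md - u t z) by rewrite mulr_ge0 ?subr_ge0// ltW.
  by clear -Thmd; lra.
rewrite kzE rhoE in Umd.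
have := qq0 (u t z); move: (r2 z / _) (u t z) (q _) (f _) (h _) Umd rho0 rho1 hC hf.
move=> rho U qU fU hU [Umd1 Umd2] rho0 rho1 hC hf q0U.
(* Contact gives q (f + h rho) <= N / L, where rho is the squared slope of the bump; the bound would
   yield q0 kap / 2 <= N / L, contrary to [Lq]. *)
suff Hk : kap / 2 <= fU + hU * rho.
  have H1 : q0 * (kap / 2) <= qU * (fU + hU * rho).
    by apply: ler_pM => //; rewrite ?(ltW q00)// divr_ge0// ltW.
  by move=> /(le_trans H1); rewrite ler_pdivlMr//; clear -Lq; lra.
(* If u >= md, then f + h rho is a convex combination of f and f + h, both at least kap. If u < md,
   then L / 2 (1 - rho) = Th(u) <= Z, so rho is close to 1 and [LZ] bounds the error h (1 - rho) by
   kap / 2. *)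
have [/Umd1 kf|/Umd2 ThU] := leP md U.
  have -> : fU + hU * rho = (1 - rho) * fU + rho * (hU + fU) by clear; ring.
  have h1 : (1 - rho) * kap <= (1 - rho) * fU by rewrite ler_wpM2l ?subr_ge0.
  have h2 : rho * kap <= rho * (hU + fU) by rewrite ler_wpM2l.
  by clear -h1 h2 kap0; lra.
have -> : fU + hU * rho = (hU + fU) - hU * (1 - rho) by clear; ring.
have h1 : hU * (1 - rho) <= Ch * (1 - rho).
  by rewrite ler_wpM2r ?subr_ge0// (le_trans (ler_norm _)).
have h2 : L * (Ch * (1 - rho)) <= L * (kap / 2).
  have h3 : Ch * (L / 2 * (1 - rho)) <= Ch * Z by rewrite ler_pM2l.
  by clear -h3 LZ; lra.
rewrite ler_pM2l// in h2; clear -h1 h2 hf; lra.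
Qed.

(** * The state 1 on the right *)

Lemma subset_closure_point {T : topologicalType} (A : set T) (x : T) : A x -> closure A x.
Proof. by move=> Ax W nW; exists x; split => //; exact: nbhs_singleton. Qed.

(* Doubling of variables: u(X) - u(Y), with X - Y parallel to e_i, is compared on a cube with
   a paraboloid which is concave in |X - Y|. *)
Lemma interior_modulus {R : realType} {n : nat} (f : R -> R) (K : set 'rV[R]_n.+2)
    (g : 'rV[R]_n.+2 -> R) (u : R -> 'rV[R]_n.+2 -> R) (F : R) :
  entire_solution f K g u -> (forall s : R, 0 <= s <= 1 -> `|f s| <= F) ->
  forall (t : R) (x0 : 'rV[R]_n.+2) (i : 'I_n.+2) (b d : R), b ^+ 2 = 1 -> 0 <= d <= 1 / 2 ->
  (forall y : 'rV[R]_n.+2, (forall j, x0 0 j - 1 / 2 <= y 0 j <= x0 0 j + 1 / 2) -> (~` K) y) ->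
  u t x0 - u t (x0 + (b * d) *: e_ R i) <= (F + 4) * (2 * n.+2%:R + 3) * d.
Proof.
move=> sol fF t1 x0 i b d b2 hd cubeK.
have [cu [du [_ [_ [pde [_ u01]]]]]] := sol.
have F0 : 0 <= F by have := fF 0; rewrite lexx ler01 => /(_ isT); apply: le_trans.
have [N NE] : exists N : R, N = n.+2%:R by exists n.+2%:R.
have N2 : 2 <= N by rewrite NE ler_nat.
have N0 : 0 <= N by rewrite NE.
have [C CE] : exists C : R, C = F + 4 by exists (F + 4).
have C4 : 4 <= C by clear -CE F0; lra.
have C0 : 0 <= C by clear -C4; lra.
rewrite -NE -CE.
(* The slack eps makes the comparison strict on the diagonal, where the two points coincide. *)
apply/ler_addgt0Pl => eps eps0; rewrite leNgt; apply/negP => bad.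
pose cube := [set y : 'rV[R]_n.+2 | forall j, x0 0 j - 1 / 2 <= y 0 j <= x0 0 j + 1 / 2].
pose Yi (z : 'rV[R]_n.+2 * R) := z.1 0 i + b * z.2.
pose Y (z : 'rV[R]_n.+2 * R) := z.1 + (b * z.2) *: e_ R i.
pose D := (cube `*` `[(0:R), 1]) `&` (Yi @^-1` `[x0 0 i - 1 / 2, x0 0 i + 1 / 2]).
have cYi : continuous Yi.
  move=> z; apply: cvgD.
    apply: (@continuous_comp _ _ _ fst (fun x : 'rV[R]_n.+2 => x 0 i)); first exact: cvg_fst.
    exact: continuous_coord.
  by apply: cvgM; [exact: cvg_cst|exact: cvg_snd].
have cY : continuous Y.
  move=> z; apply: cvgD; first exact: cvg_fst.
  by apply: cvgZr_tmp; apply: cvgM; [exact: cvg_cst|exact: cvg_snd].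
have Ycoord z j : Y z 0 j = if j == i then Yi z else z.1 0 j.
  by rewrite /Y add_e_coord /Yi; case: eqVneq => [->|_]; rewrite ?mulr1 ?mulr0 ?addr0.
have cD : compact D.
  apply: compact_closedI.
    by apply: compact_setX; [exact: compact_box|exact: segment_compact].
  apply: closed_comp; last exact: itv_closed.
  by move=> z _; exact: cYi.
have DX z : D z -> (~` K) z.1 by move=> [[/= cz _] _]; exact: cubeK.
have DY z : D z -> (~` K) (Y z).
  move=> [[/= cz _]]; rewrite in_itv /= => Yz; apply: cubeK => j.
  by rewrite Ycoord; case: eqP => [->|].
pose P2 (z : 'rV[R]_n.+2 * R) := \sum_j (z.1 0 j - x0 0 j) ^+ 2.
(* With r = |X - Y|, the profile 2 r - r^2 is increasing and strictly concave on [0, 1]; its weight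
   N + 1 outdoes the convexity of the localising squares. These squares and t1 - s, times C >= 4,
   reach 1, which bounds the oscillation of u, on the faces of the cube and at time t1 - 1. *)
pose W (p : R * ('rV[R]_n.+2 * R)) :=
  C * ((N + 1) * (2 * p.2.2 - p.2.2 ^+ 2) + P2 p.2 + (Yi p.2 - x0 0 i) ^+ 2 + (t1 - p.1)) + eps.
pose k (p : R * ('rV[R]_n.+2 * R)) := W p - (u p.1 p.2.1 - u p.1 (Y p.2)).
have cW : continuous W.
  have c2 : continuous (fun p : R * ('rV[R]_n.+2 * R) => p.2.2).
    by move=> p; apply: (@continuous_comp _ _ _ snd snd); exact: cvg_snd.
  have cP2 : continuous (fun p : R * ('rV[R]_n.+2 * R) => P2 p.2).
    move=> p; apply: (@continuous_comp _ _ _ snd P2); first exact: cvg_snd.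
    apply: (@continuous_comp _ _ _ fst (fun x : 'rV[R]_n.+2 => \sum_j (x 0 j - x0 0 j) ^+ 2)).
      exact: cvg_fst.
    exact: continuous_sum_sqr.
  have cY2 : continuous (fun p : R * ('rV[R]_n.+2 * R) => (Yi p.2 - x0 0 i) ^+ 2).
    move=> p; apply: (@continuous_comp _ _ _ (fun p => Yi p.2 - x0 0 i) (fun y => y ^+ 2));
      last exact: exprn_continuous.
    apply: cvgB; last exact: cvg_cst.
    by apply: (@continuous_comp _ _ _ snd Yi); [exact: cvg_snd|exact: cYi].
  move=> p; apply: cvgD; last exact: cvg_cst.
  apply: cvgM; first exact: cvg_cst.
  apply: cvgD; last by apply: cvgB; [exact: cvg_cst|exact: cvg_fst].
  apply: cvgD; last exact: cY2.
  apply: cvgD; last exact: cP2.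
  apply: cvgM; first exact: cvg_cst.
  apply: cvgB; first by apply: cvgM; [exact: cvg_cst|exact: c2].
  apply: (@continuous_comp _ _ _ (fun p : R * ('rV[R]_n.+2 * R) => p.2.2) (fun y => y ^+ 2));
    [exact: c2|exact: exprn_continuous].
have cuv (a : R * ('rV[R]_n.+2 * R) -> 'rV[R]_n.+2) : continuous a ->
    (forall p, D p.2 -> (~` K) (a p)) ->
    {within `[t1 - 1, t1] `*` D, continuous (fun p => u p.1 (a p))}.
  move=> ca aK; apply/subspace_continuousP => p [_ Dp].
  have aKp := aK p Dp.
  have := (subspace_continuousP _ _).1 cu (p.1, a p) (subset_closure_point _ _ aKp).
  move=> H W0 nW; have := H W0 nW.
  have c1 : q.1 @[q --> p] --> p.1 by exact: cvg_fst.
  have cpa : (q.1, a q) @[q --> p] --> (p.1, a p) by exact: (cvg_pair c1 (ca p)).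
  rewrite /within /= => /cpa; apply: (@filterS _ _ (nbhs_filter p)) => q /= Hq [_ Dq].
  by apply: Hq; exact: (subset_closure_point _ _ (aK q Dq)).
have ck : {within `[t1 - 1, t1] `*` D, continuous k}.
  apply: within_continuousB; first exact: continuous_subspaceT.
  apply: within_continuousB.
    apply: (cuv (fun p => p.2.1)) => [p|p /DX//].
    by apply: (@continuous_comp _ _ _ snd fst); [exact: cvg_snd|exact: cvg_fst].
  apply: (cuv (fun p => Y p.2)) => [p|p /DY//].
  by apply: (@continuous_comp _ _ _ snd Y); [exact: cvg_snd|exact: cY].
have P20 z : 0 <= P2 z by apply: sumr_ge0 => j _; exact: sqr_ge0.
have diff1 s z : D z -> u s z.1 - u s (Y z) < 1.
  by move=> Dz; have := u01 s _ (DX z Dz); have := u01 s _ (DY z Dz); clear; lra.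
have Dr z : D z -> 0 <= z.2 <= 1 by move=> [[/= _]]; rewrite in_itv.
have rr z : D z -> 0 <= (N + 1) * (2 * z.2 - z.2 ^+ 2).
  by move=> /Dr z2; rewrite mulr_ge0//; [clear -N2; lra|clear -z2; nra].
case: (compact_first_zero D (t1 - 1) t1 k cD ck).
- move=> z Dz; rewrite /k /= subr_gt0 (lt_trans (diff1 _ _ Dz))// /W /=.
  have := rr z Dz; have := P20 z; have := sqr_ge0 (Yi z - x0 0 i).
  move: (_ * (2 * _ - _)) (_ ^+ 2) (P2 z) => r1 r3 r2 h1 h2 h3.
  have H : 0 <= C * (r1 + r2 + r3) by rewrite mulr_ge0 ?addr_ge0.
  by rewrite subKr mulrDr mulr1; clear -H C4 eps0; lra.
(* Here W = C (2 (N + 1) d - N d^2) + eps, which is at most C (2 N + 3) d + eps. *)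
- exists t1, (x0, d); split; first by clear; lra.
    split; [split|] => /=; rewrite /Yi /= ?in_itv /=.
    + by move=> j; clear; lra.
    + by clear -hd; lra.
    + have : (b - 1) * (b + 1) = 0 by rewrite -subr_sqr expr1n b2 subrr.
      move/eqP; rewrite mulf_eq0 => /orP[]/eqP hb.
        have b1 : b = 1 by clear -hb; lra.
        by rewrite b1; clear -hd; lra.
      have b1 : b = -1 by clear -hb; lra.
      by rewrite b1; clear -hd; lra.
  rewrite /k /W /P2 /Yi /Y /= big1; last by move=> j _; rewrite subrr expr0n.
  rewrite (_ : x0 0 i + b * d - x0 0 i = b * d); last by ring.
  rewrite exprMn b2.
  have h1 : 0 <= C * N * d ^+ 2 by apply: mulr_ge0; [exact: mulr_ge0|exact: sqr_ge0].
  have h2 : 0 <= C * d by case/andP: hd => d0 _; rewrite mulr_ge0.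
  by move: (u t1 x0) (u t1 _) bad => a1 a2 bad; clear -h1 h2 bad; lra.
move=> s [z [/andP[s0 s1] Dz kz kge kpos]].
have {bad} kzE : u s z.1 - u s (Y z) = W (s, z) by apply/esym/eqP; rewrite -subr_eq0; exact/eqP.
have Wlow : C * (P2 z + (Yi z - x0 0 i) ^+ 2) < 1.
  have := diff1 s z Dz; rewrite kzE /W /=; have := rr z Dz.
  move: ((N + 1) * _) ((Yi z - _) ^+ 2) (P2 z) => r1 r3 r2 h1 h2.
  have h3 : 0 <= C * r1 by rewrite mulr_ge0.
  have h4 : 0 <= C * (t1 - s) by rewrite mulr_ge0// subr_ge0.
  by move: h2; rewrite !mulrDr -!mulrDr; clear -h3 h4 eps0; lra.
have small (y : R) : C * y ^+ 2 < 1 -> - (1 / 2) < y < 1 / 2.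
  by move=> Cy; rewrite -ltr_norml -ltr_sqr ?nnegrE ?divr_ge0// real_normK ?num_real//; clear -Cy C4; nra.
have Xj j : - (1 / 2) < z.1 0 j - x0 0 j < 1 / 2.
  apply: small; apply: le_lt_trans Wlow; rewrite ler_wpM2l//.
  rewrite /P2 (bigD1 j)//= -addrA lerDl addr_ge0 ?sqr_ge0// sumr_ge0// => l _.
  exact: sqr_ge0.
have Yj : - (1 / 2) < Yi z - x0 0 i < 1 / 2.
  by apply: small; apply: le_lt_trans Wlow; rewrite ler_wpM2l// lerDr.
have absb : `|b| = 1 by rewrite -sqrtr_sqr b2 sqrtr1.
(* At r = 0 the difference of u vanishes while W >= eps. The value r = 1 would separate by 1 two
   points whose i-th coordinates are both strictly within 1 / 2 of that of x0. *)
have [r0 r1] : 0 < z.2 /\ z.2 < 1.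
  have /andP[z0 z1] := Dr z Dz; split.
    rewrite lt_neqAle z0 andbT; apply/eqP => z20.
    have E : Y z = z.1 by rewrite /Y -z20 mulr0 scale0r addr0.
    move: kzE; rewrite E subrr /W /= => /esym/eqP.
    rewrite gt_eqF// ltr_wpDl//; apply: mulr_ge0 => //.
    apply: addr_ge0; last by rewrite subr_ge0.
    apply: addr_ge0; last exact: sqr_ge0.
    by apply: addr_ge0; [exact: rr|exact: P20].
  have := Xj i; have : z.2 = `|Yi z - z.1 0 i|.
    rewrite (_ : Yi z - z.1 0 i = b * z.2); last by rewrite /Yi; ring.
    by rewrite normrM absb mul1r ger0_norm.
  by move=> -> Xi; rewrite ltr_norml; clear -Xi Yj; lra.
have [dtX dX] := du s _ (DX z Dz); have [dtY dY] := du s _ (DY z Dz).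
have pX := pde s _ (DX z Dz); have pY := pde s _ (DY z Dz).
have line (x : 'rV[R]_n.+2) j e : (forall r : R, `|r| < e -> (~` K) (x + r *: e_ R j)) ->
    forall r : R, `|r| < e ->
    is_derive r 1 (fun r : R => u s (x + r *: e_ R j)) ('D_(e_ R j) (u s) (x + r *: e_ R j)).
  move=> xK r re; apply: is_derive_along_line.
  have [_ /(_ j)[d1 _]] := du s _ (xK r re).
  exact: d1.
have line2 (x : 'rV[R]_n.+2) j : (~` K) x ->
    is_derive (0 : R) 1 (fun r : R => 'D_(e_ R j) (u s) (x + r *: e_ R j))
      ('D_(e_ R j) ('D_(e_ R j) (u s)) x).
  move=> xK; have [_ /(_ j)[_ d2]] := du s x xK.
  exact: (is_derive_along_line0 ('D_(e_ R j) (u s)) x (e_ R j) d2).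
have nonneg z' : D z' -> u s z'.1 - u s (Y z') <= W (s, z') by move=> /kge; rewrite /k /= subr_ge0.
have P2move (z' : 'rV[R]_n.+2 * R) j (r r' : R) :
    P2 (z'.1 + r *: e_ R j, r') = P2 z' + 2 * (z'.1 0 j - x0 0 j) * r + r ^+ 2.
  rewrite /P2 /= (bigD1 j)//= [in RHS](bigD1 j)//= add_e_coord eqxx mulr1.
  rewrite (eq_bigr (fun l => (z'.1 0 l - x0 0 l) ^+ 2)); first by clear; ring.
  by move=> l lj; rewrite add_e_coord (negbTE lj) mulr0 addr0.
have step j : exists2 e : R, 0 < e & forall r : R, `|r| < e ->
   [/\ - (1 / 2) < z.1 0 j + r - x0 0 j < 1 / 2, - (1 / 2) < Yi z + r - x0 0 i < 1 / 2,
     0 < z.2 + b * r < 1 & 0 < z.2 - b * r < 1].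
  exists (Num.min (Num.min (1 / 2 - `|z.1 0 j - x0 0 j|) (1 / 2 - `|Yi z - x0 0 i|))
            (Num.min z.2 (1 - z.2))).
    by rewrite !lt_min !subr_gt0 !ltr_norml Xj Yj r0.
  move=> r; rewrite !lt_min => /andP[/andP[h1 h2] /andP[h3 h4]].
  have br : `|b * r| = `|r| by rewrite normrM absb mul1r.
  have half (y : R) : `|r| < 1 / 2 - `|y| -> - (1 / 2) < y + r < 1 / 2.
    by rewrite ltrBrDl -ltr_norml; apply: le_lt_trans; exact: ler_normD.
  split.
  - by rewrite addrAC; exact: half.
  - by rewrite addrAC; exact: half.
  - by move: h3 h4; rewrite -br !ltr_norml; clear; lra.
  - by move: h3 h4; rewrite -br !ltr_norml; clear; lra.
have cubez j : x0 0 j - 1 / 2 <= z.1 0 j <= x0 0 j + 1 / 2 by have := Xj j; clear; lra.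
have inner (a y : R) : - (1 / 2) < y - a < 1 / 2 -> a - 1 / 2 <= y <= a + 1 / 2.
  by clear; lra.
have inner1 (y : R) : 0 < y < 1 -> 0 <= y <= 1 by clear; lra.
have cubez' j (r : R) : - (1 / 2) < z.1 0 j + r - x0 0 j < 1 / 2 ->
    cube (z.1 + r *: e_ R j).
  move=> jr l; rewrite add_e_coord; case: eqP => [->|_]; first by rewrite mulr1 inner.
  by rewrite mulr0 addr0.
have Yiz := inner _ _ Yj.
have zr : 0 <= z.2 <= 1 := Dr z Dz.
(* X and Y are moved together in a direction orthogonal to e_i, so that r is unchanged and only the
   localising square of X bends. *)
have other j : j != i -> - (2 * C) <= 'D_(e_ R j) ('D_(e_ R j) (u s)) (Y z)
    - 'D_(e_ R j) ('D_(e_ R j) (u s)) z.1.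
  move=> ji; have [e e0 He] := step j.
  have Yr r : Y (z.1 + r *: e_ R j, z.2) = Y z + r *: e_ R j by rewrite /Y /= addrAC.
  have Yir r : Yi (z.1 + r *: e_ R j, z.2) = Yi z.
    by rewrite /Yi /= add_e_coord eq_sym (negbTE ji) mulr0 addr0.
  have Dm (r : R) : `|r| < e -> D (z.1 + r *: e_ R j, z.2).
    move=> /He[h1 h2 h3 h4]; split; [split|] => /=.
    - exact: cubez'.
    - by rewrite in_itv.
    - by rewrite Yir in_itv.
  have := @second_derivative_minorant R
    (fun r => u s (Y z + r *: e_ R j) - u s (z.1 + r *: e_ R j)) 
    (fun r => 'D_(e_ R j) (u s) (Y z + r *: e_ R j) - 'D_(e_ R j) (u s) (z.1 + r *: e_ R j)) 
    ('D_(e_ R j) ('D_(e_ R j) (u s)) (Y z) - 'D_(e_ R j) ('D_(e_ R j) (u s)) z.1)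
    (- (C * (2 * (z.1 0 j - x0 0 j)))) C e e0.
  case.
  - move=> r re; apply: is_deriveB; apply: line re => r' /Dm Dr'.
      by have := DY _ Dr'; rewrite Yr.
    exact: DX Dr'.
  - by apply: is_deriveB; apply: line2; [exact: DY|exact: DX].
  - move=> r re; have := nonneg _ (Dm r re); rewrite /= Yr !scale0r !addr0.
    have -> : u s (Y z) - u s z.1 = - W (s, z) by rewrite -kzE opprB.
    by rewrite /W /= P2move Yir; clear; lra.
  - by move=> _.
(* X alone moves, r being adjusted to keep Y fixed. The second derivative of W is then C (- 2 (N +
   1) + 2) = - 2 C N; [moveY] is the symmetric case. *)
have moveX : 2 * (C * N) <= - 'D_(e_ R i) ('D_(e_ R i) (u s)) z.1.
  have [e e0 He] := step i.
  have Yir r : Yi (z.1 + r *: e_ R i, z.2 - b * r) = Yi z.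
    rewrite /Yi /= add_e_coord eqxx mulr1 mulrBr mulrA -expr2 b2; clear; ring.
  have Yr r : Y (z.1 + r *: e_ R i, z.2 - b * r) = Y z.
    apply/rowP => l; rewrite !Ycoord Yir /= add_e_coord; case: eqP => // _.
    by rewrite mulr0 addr0.
  have Dm (r : R) : `|r| < e -> D (z.1 + r *: e_ R i, z.2 - b * r).
    move=> /He[h1 h2 h3 h4]; split; [split|] => /=.
    - exact: cubez'.
    - by rewrite in_itv /= inner1.
    - by rewrite Yir in_itv.
  have := @second_derivative_minorant R (fun r => - u s (z.1 + r *: e_ R i)) 
    (fun r => - 'D_(e_ R i) (u s) (z.1 + r *: e_ R i)) 
    (- 'D_(e_ R i) ('D_(e_ R i) (u s)) z.1)
    (- (C * ((N + 1) * (- (2 * b) + 2 * z.2 * b) + 2 * (z.1 0 i - x0 0 i)))) (- (C * N)) e e0.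
  case.
  - move=> r re; apply: is_deriveN; apply: line re => r' /Dm; exact: DX.
  - by apply: is_deriveN; apply: line2; exact: DX.
  - move=> r re; have := nonneg _ (Dm r re); rewrite /= Yr !scale0r !addr0.
    have -> : u s z.1 = W (s, z) + u s (Y z) by rewrite -kzE subrK.
    rewrite /W /= P2move Yir.
    have -> : (z.2 - b * r) ^+ 2 = z.2 ^+ 2 - 2 * z.2 * b * r + r ^+ 2.
      by rewrite sqrrB exprMn b2 mul1r; clear; ring.
    by clear; lra.
  - by move=> _; rewrite mulrN opprK.
have moveY : 2 * (C * N) <= 'D_(e_ R i) ('D_(e_ R i) (u s)) (Y z).
  have [e e0 He] := step i.
  have Yir r : Yi (z.1, z.2 + b * r) = Yi z + r.
    by rewrite /Yi /= mulrDr mulrA -expr2 b2; clear; ring.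
  have Yr r : Y (z.1, z.2 + b * r) = Y z + r *: e_ R i.
    by rewrite /Y /= -addrA -scalerDl mulrDr mulrA -expr2 b2 mul1r.
  have Dm (r : R) : `|r| < e -> D (z.1, z.2 + b * r).
    move=> /He[h1 h2 h3 h4]; split; [split|] => /=.
    - exact: cubez.
    - by rewrite in_itv /= inner1.
    - by rewrite Yir in_itv /= inner.
  have := @second_derivative_minorant R (fun r => u s (Y z + r *: e_ R i)) 
    (fun r => 'D_(e_ R i) (u s) (Y z + r *: e_ R i)) 
    ('D_(e_ R i) ('D_(e_ R i) (u s)) (Y z))
    (- (C * ((N + 1) * (2 * b - 2 * z.2 * b) + 2 * (Yi z - x0 0 i)))) (- (C * N)) e e0.
  case.
  - by move=> r re; apply: line re => r' /Dm Dr'; have := DY _ Dr'; rewrite Yr.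
  - by apply: line2; exact: DY.
  - move=> r re; have := nonneg _ (Dm r re); rewrite /= Yr !scale0r !addr0.
    have -> : u s z.1 = W (s, z) + u s (Y z) by rewrite -kzE subrK.
    have P2r : P2 (z.1, z.2 + b * r) = P2 z by [].
    rewrite /W /= P2r Yir.
    have -> : (z.2 + b * r) ^+ 2 = z.2 ^+ 2 + 2 * z.2 * b * r + r ^+ 2.
      by rewrite sqrrD exprMn b2 mul1r; clear; ring.
    by clear; lra.
  - by move=> _; rewrite mulrN opprK.
have time : - C <= derive1 (fun s => u s z.1) s - derive1 (fun s => u s (Y z)) s.
  have dd : is_derive s 1 (fun r : R => u r z.1 - u r (Y z))
      (derive1 (fun s => u s z.1) s - derive1 (fun s => u s (Y z)) s).
    apply: is_deriveB; rewrite derive1E.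
      exact: (derivableP dtX).
    exact: (derivableP dtY).
  move: (_ - _) dd => d1 dd; rewrite leNgt; apply/negP => d1C.
  have [e e0 He] := is_derive1_approx _ _ _ dd ((- C - d1) / 2) ltac:(clear -d1C; lra).
  pose r := Num.min e (s - (t1 - 1)) / 2.
  have sm : 0 < Num.min e (s - (t1 - 1)) by rewrite lt_min e0 subr_gt0.
  have r_gt0 : 0 < r by rewrite divr_gt0.
  have rm : r < Num.min e (s - (t1 - 1)) by rewrite /r; clear -sm; lra.
  have /andP[re rs] : (r < e) && (r < s - (t1 - 1)) by rewrite -lt_min.
  have := He (- r); rewrite normrN (gtr0_norm r_gt0) => /(_ re) /ler_normlP[+ _] /=.
  rewrite kzE.
  have := kpos (s - r) z ltac:(clear -rs r_gt0; lra) Dz; rewrite /k /= subr_gt0 /W /= => h1 h2.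
  have h3 : 0 < (- C - d1) * r by rewrite mulr_gt0// subr_gt0.
  by clear -h1 h2 h3; lra.
(* The two moves along e_i give 4 C N, and the other N - 1 directions lose at most 2 C each. The
   equation then forces 2 C N + C <= 2 F, impossible for C = F + 4. *)
have lap : 2 * (C * N) + 2 * C <= \sum_j ('D_(e_ R j) ('D_(e_ R j) (u s)) (Y z)
    - 'D_(e_ R j) ('D_(e_ R j) (u s)) z.1).
  rewrite (bigD1 i)//=.
  have : \sum_(j < n.+2 | j != i) - (2 * C) <= \sum_(j < n.+2 | j != i)
     ('D_(e_ R j) ('D_(e_ R j) (u s)) (Y z) - 'D_(e_ R j) ('D_(e_ R j) (u s)) z.1).
    by apply: ler_sum => j; exact: other.
  have : \sum_(j < n.+2) - (2 * C) = - (2 * C) * N.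
    by rewrite sumr_const card_ord NE mulr_natr.
  have arith (A S x y : R) : A <= S -> - (2 * C) + A = - (2 * C) * N ->
      2 * (C * N) <= - x -> 2 * (C * N) <= y -> 2 * (C * N) + 2 * C <= y - x + S.
    by clear; lra.
  rewrite (bigD1 i)//= => h2 h1; exact: arith h1 h2 moveX moveY.
have fY : f (u s (Y z)) >= - F.
  have : `|f (u s (Y z))| <= F by apply: fF; have := u01 s _ (DY z Dz); clear; lra.
  by rewrite ler_norml => /andP[].
have fX : f (u s z.1) <= F.
  have : `|f (u s z.1)| <= F by apply: fF; have := u01 s _ (DX z Dz); clear; lra.
  by rewrite ler_norml => /andP[].
rewrite pX pY sumrB in time lap *.
have CN : C * 2 <= C * N by rewrite ler_wpM2l.
have arith (S1 S2 f1 f2 : R) : - C <= S1 + f1 - (S2 + f2) ->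
    2 * (C * N) + 2 * C <= S2 - S1 -> f1 <= F -> - F <= f2 -> False.
  by clear -CE CN F0; lra.
exact: arith time lap fX fY.
Qed.

(** The modulus along single axes is added up over a path of axis-parallel legs. The margin in x_1
    is the total length of the path, so no intermediate point leaves the region where the modulus
    holds. *)
Lemma chain_modulus {R : realType} {n : nat} (w : 'rV[R]_n.+2 -> R) (A C : R) : 0 <= C ->
  (forall (x : 'rV[R]_n.+2) i (d : R), A <= x 0 0 -> `|d| <= 1 / 2 -> w x - w (x + d *: e_ R i) <= C * `|d|) ->
  forall (l : seq 'I_n.+2) (k : 'I_n.+2 -> R) (x : 'rV[R]_n.+2), (forall j, `|k j| <= 1 / 2) ->
    A <= x 0 0 - \sum_(j <- l) `|k j| ->
    w x - w (x + \sum_(j <- l) k j *: e_ R j) <= C * \sum_(j <- l) `|k j|.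
Proof.
move=> C0 H; elim=> [|i l IH] k x k1; first by rewrite !big_nil !addr0 subrr mulr0.
rewrite !big_cons addrA => Ax.
have S0 : 0 <= \sum_(j <- l) `|k j| by apply: sumr_ge0.
have ki := normr_ge0 (k i).
have x1 : A <= x 0 0 by clear -Ax S0 ki; lra.
have x2 : A <= (x + k i *: e_ R i) 0 0 - \sum_(j <- l) `|k j|.
  rewrite add_e_coord; have : - `|k i| <= k i * (0 == i)%:R.
    case: eqP => _; rewrite ?mulr1 ?mulr0 ?oppr_le0//; exact: lerNnormlW.
  by clear -Ax; lra.
have := IH k _ k1 x2; have := H x i (k i) x1 (k1 i).
by clear; lra.
Qed.

(** A Lipschitz bound uniform in t makes pointwise convergence at one point hold, up to e / 2, on a
    whole neighbourhood from the same time on; compactness of the lateral face then gives a single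
    time T. *)
Lemma right_state {R : realType} {n : nat} (f : R -> R) (K : set 'rV[R]_n.+2)
    (g : 'rV[R]_n.+2 -> R) (M : R) (u : R -> 'rV[R]_n.+2 -> R) (v : 'rV[R]_n.+2 -> R) :
  continuous f -> K `<=` [set x | 0 <= x1 x <= M] -> entire_solution f K g u ->
  (forall x, (~` K) x -> u t x @[t --> +oo] --> v x) -> propagation K v ->
  forall e : R, 0 < e -> exists A0 : R, forall A L : R, A0 <= A -> forall x0 : 'rV[R]_n.+2,
  exists T : R, forall (t : R) (x : 'rV[R]_n.+2), T <= t -> x 0 0 = A ->
    (forall j, j != 0 -> `|x 0 j - x0 0 j| <= L) -> 1 - e <= u t x.
Proof.
move=> cf KM sol uv prop e e0.
have [F fF] : exists F : R, forall s : R, 0 <= s <= 1 -> `|f s| <= F.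
  have cnf : {within `[(0 : R), 1], continuous (fun s => `|f s|)}.
    by apply: continuous_subspaceT => y; apply: cvg_norm; exact: cf.
  have [c _ cM] := EVT_max ler01 cnf.
  by exists `|f c| => s s01; apply: cM; rewrite in_itv.
have F0 : 0 <= F by have := fF 0; rewrite lexx ler01 => /(_ isT); apply: le_trans.
have OK (x : 'rV[R]_n.+2) : M < x 0 0 -> (~` K) x.
  by move=> xM /KM /= /andP[_]; rewrite leNgt /x1 xM.
pose C := (F + 4) * (2 * n.+2%:R + 3).
have C0 : 0 <= C by rewrite mulr_ge0// addr_ge0// mulr_ge0.
have mod1 t (x : 'rV[R]_n.+2) i (d : R) : M + 1 <= x 0 0 -> `|d| <= 1 / 2 ->
    u t x - u t (x + d *: e_ R i) <= C * `|d|.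
  move=> xM d2.
  pose b : R := if 0 <= d then 1 else -1.
  have db : d = b * `|d|.
    rewrite /b; case: (leP 0 d) => hd; first by rewrite mul1r ger0_norm.
    by rewrite mulN1r ltr0_norm// opprK.
  have b2 : b ^+ 2 = 1 by rewrite /b; case: ifP; rewrite ?sqrrN expr1n.
  rewrite {1}db; apply: (interior_modulus f K g u F sol fF t x i b) => //.
    by rewrite normr_ge0.
  by move=> y /(_ 0) /andP[y0 _]; apply: OK; clear -y0 xM; lra.
have [A1 HA1] := prop (e / 4) ltac:(clear -e0; lra).
exists (Num.max A1 (M + 2)) => A L; rewrite ge_max => /andP[AA1 AM] x0.
(* The face is a box whose first edge is the degenerate interval [A, A]. *)
pose S := [set x : 'rV[R]_n.+2 |
  forall j, (if j == 0 then A else x0 0 j - L) <= x 0 j <= (if j == 0 then A else x0 0 j + L)].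
have cS : compact S := compact_box _ _.
have : \forall t \near +oo, S `<=` (fun x => x 0 0 = A -> 1 - e <= u t x).
  apply: ((compact_near_coveringP S).1 cS R (pinfty_nbhs R)
     (fun t x => x 0 0 = A -> 1 - e <= u t x)) => x Sx.
  have xA : x 0 0 = A.
    by apply/eqP; rewrite eq_le; have := Sx 0; rewrite eqxx andbC.
  have Kx : (~` K) x by apply: OK; rewrite xA; clear -AM; lra.
  have vx : 1 - e / 4 <= v x.
    have := HA1 x Kx; rewrite /x1 xA => /(_ AA1); rewrite ler_norml => /andP[h _].
    by clear -h; lra.
  have ut : \forall t \near +oo, v x - e / 4 < u t x.
    by apply: (cvgr_gt _ (uv x Kx)); clear -e0; lra.
  pose N : R := n.+2%:R.
  have N0 : 0 < N by rewrite ltr0n.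
  (* The first bound keeps the path shorter than 1 / 2, hence in x_1 >= M + 1, and the second limits
     the variation of u along it to e / 2. Propagation and convergence in time take e / 4 each. *)
  pose r := Num.min (1 / (2 * N)) (e / (2 * (C + 1) * N)).
  have r_gt0 : 0 < r.
    by rewrite lt_min !divr_gt0// ?mulr_gt0// ltr_wpDl.
  have rN : r * N <= 1 / 2.
    rewrite -ler_pdivlMr//; apply: (le_trans (_ : r <= 1 / (2 * N))); first by rewrite ge_min lexx.
    by rewrite invfM mulrA.
  have rC : C * (r * N) <= e / 2.
    have : r <= e / (2 * (C + 1) * N) by rewrite ge_min lexx orbT.
    rewrite ler_pdivlMr ?mulr_gt0 ?ltr_wpDl// => h.
    have : 0 <= r * N by rewrite mulr_ge0// ltW.
    by clear -h; lra.
  have xr : \forall y \near x, `|x - y| < r 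
    by apply/nbhs_ballP; exists r => // y; rewrite -ball_normE.
  exists ([set y | `|x - y| < r], [set t | v x - e / 4 < u t x]) => //=.
  move=> [y t] /= [xy tx] yA.
  have sumk : \sum_j `|(y - x) 0 j| <= r * N.
    rewrite /N -[in leRHS](card_ord n.+2) mulr_natr -sumr_const; apply: ler_sum => j _.
    by rewrite (le_trans (coord_le_norm _ _))// distrC ltW.
  have := chain_modulus (u t) (M + 1) C C0 (mod1 t) (index_enum 'I_n.+2) (fun j => (y - x) 0 j) x.
  have yE : x + \sum_j (y - x) 0 j *: e_ R j = y by rewrite -row_sum_e addrC subrK.
  rewrite yE => H.
  have {H} : u t x - u t y <= C * \sum_j `|(y - x) 0 j|.
    apply: H.
      move=> j; rewrite (le_trans _ rN)// (le_trans _ sumk)// (bigD1 j)//= lerDl.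
      by apply: sumr_ge0.
    by rewrite xA; clear -sumk rN AM; lra.
  have : C * \sum_j `|(y - x) 0 j| <= C * (r * N) by rewrite ler_wpM2l.
  by clear -rC tx vx; lra.
move=> [T [_ HT]]; exists (T + 1) => t x Tt xA xL.
apply: (HT t) => //; first by clear -Tt; lra.
move=> j; case: eqP => [->|/eqP j0]; first by rewrite xA lexx.
by have := xL j j0; rewrite ler_norml; clear; lra.
Qed.

(** * The boundary of the wall *)

Lemma scale_grad {R : realType} {n : nat} (g : 'rV[R]_n.+2 -> R) (x : 'rV[R]_n.+2) (h : R) :
  h *: grad g x = \sum_j (h * 'D_(e_ R j) g x) *: e_ R j.
Proof. by rewrite [LHS]row_sum_e; apply: eq_bigr => j _; rewrite !mxE. Qed.

Lemma grad_taylor {R : realType} {n : nat} (g : 'rV[R]_n.+2 -> R) (G : R) (x : 'rV[R]_n.+2) :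
  (forall y i, `|'D_(e_ R i) g y| <= G) ->
  (forall (l : seq 'I_n.+2) (k : 'I_n.+2 -> R) y,
    `|g (y + \sum_(j <- l) k j *: e_ R j) - g y - \sum_(j <- l) 'D_(e_ R j) g y * k j|
      <= G * (\sum_(j <- l) `|k j|) ^+ 2) ->
  forall h : R, 0 <= h ->
  g x + h * (\sum_j ('D_(e_ R j) g x) ^+ 2) - G * (n.+2%:R * G) ^+ 2 * h ^+ 2
    <= g (x + h *: grad g x).
Proof.
move=> gG gT h h0.
have G0 : 0 <= G by apply: le_trans (gG x 0).
have := gT (index_enum 'I_n.+2) (fun j => h * 'D_(e_ R j) g x) x.
rewrite -scale_grad.
have -> : \sum_j 'D_(e_ R j) g x * (h * 'D_(e_ R j) g x) = h * \sum_j ('D_(e_ R j) g x) ^+ 2.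
  by rewrite mulr_sumr; apply: eq_bigr => j _; rewrite expr2 mulrCA.
have -> : \sum_j `|h * 'D_(e_ R j) g x| = h * \sum_j `|'D_(e_ R j) g x|.
  by rewrite mulr_sumr; apply: eq_bigr => j _; rewrite normrM ger0_norm.
have SG : \sum_j `|'D_(e_ R j) g x| <= n.+2%:R * G.
  by rewrite -[in leRHS](card_ord n.+2) mulr_natl -sumr_const; apply: ler_sum.
have S0 : 0 <= \sum_j `|'D_(e_ R j) g x| by apply: sumr_ge0.
have : G * (h * \sum_j `|'D_(e_ R j) g x|) ^+ 2 <= G * (n.+2%:R * G) ^+ 2 * h ^+ 2.
  rewrite -mulrA ler_wpM2l// -exprMn lerXn2r ?nnegrE ?mulr_ge0// mulrC ler_wpM2r//.
rewrite ler_norml => h1 /andP[h2 _]; move: h1 h2.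
move: (g _) (g x) (\sum_j _ ^+ 2) (_ * _ ^+ 2) (_ * _ ^+ 2) => a1 a2 a3 a4 a5.
by clear; lra.
Qed.

Lemma quadratic_small {R : realType} (a b : R) : 0 < a -> 0 <= b ->
  exists2 d : R, 0 < d & forall h : R, 0 < h < d -> b * h ^+ 2 < a * h.
Proof.
move=> a0 b0; exists (a / (b + 1)); first by rewrite divr_gt0// ltr_wpDl.
move=> h /andP[h0]; rewrite ltr_pdivlMr ?ltr_wpDl// => ha.
by rewrite expr2 mulrA ltr_pM2r//; clear -h0 ha b0; lra.
Qed.

Lemma neumann_approx {R : realType} {n : nat} (w : 'rV[R]_n.+2 -> R) (x y : 'rV[R]_n.+2) :
  (fun h => (w (x + h *: y) - w x) / h) @ 0^'+ --> 0 ->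
  forall eps : R, 0 < eps -> exists2 d : R, 0 < d & forall h : R, 0 < h < d ->
    `|w (x + h *: y) - w x| <= eps * h.
Proof.
move=> /cvgrPdist_le H eps eps0; have [d /= d0 Hd] := H eps eps0.
exists d => // h /andP[h0 hd].
have := Hd h; rewrite /= sub0r normrN gtr0_norm// => /(_ hd h0).
by rewrite sub0r normrN normrM normfV (gtr0_norm h0) ler_pdivrMr.
Qed.

(* Hopf-type exclusion of a boundary contact: the Neumann condition makes Th o u flat along
   the inward direction, whereas the barrier increases at rate rho. *)
Lemma neumann_no_touch {R : realType} {n : nat} (w : 'rV[R]_n.+2 -> R) (x y : 'rV[R]_n.+2)
    (Th : R -> R) (q rho d : R) :
  (fun h => (w (x + h *: y) - w x) / h) @ 0^'+ --> 0 ->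
  is_derive (w x) 1 Th q -> 0 < rho -> 0 < d ->
  (forall h : R, 0 < h < d -> Th (w x) + rho * h <= Th (w (x + h *: y))) -> False.
Proof.
move=> nw dTh rho0 d0 H.
have [d1 d10 H1] := is_derive1_approx Th (w x) q dTh 1 ltr01.
have Q0 : 0 < `|q| + 1 by rewrite ltr_wpDl.
pose eps := Num.min 1 (rho / (2 * (`|q| + 1))).
have eps0 : 0 < eps by rewrite lt_min ltr01 divr_gt0// mulr_gt0.
have [d2 d20 H2] := neumann_approx w x y nw eps eps0.
pose h := Num.min (Num.min d d1) d2 / 2.
have m0 : 0 < Num.min (Num.min d d1) d2 by rewrite !lt_min d0 d10.
have h0 : 0 < h by rewrite divr_gt0.
have : h < Num.min (Num.min d d1) d2 by rewrite /h; clear -m0; lra.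
rewrite !lt_min => /andP[/andP[hd hd1] hd2].
have := H2 h; rewrite h0 hd2 => /(_ isT) wh.
set D := w (x + h *: y) - w x in wh.
have epsh : eps * h <= h by rewrite ler_piMl ?(ltW h0)// ge_min lexx.
have Dd1 : `|D| < d1 by rewrite (le_lt_trans wh)// (le_lt_trans epsh).
have wE : w x + D = w (x + h *: y) by rewrite /D addrC subrK.
have := H1 D Dd1; rewrite mul1r wE => /ler_normlP[_ T1].
have := H h; rewrite h0 hd => /(_ isT) T2.
have T3 : q * D <= `|q| * `|D| by rewrite -normrM ler_norm.
have T4 : (`|q| + 1) * `|D| <= (`|q| + 1) * (eps * h) by rewrite ler_pM2l.
have T5 : (`|q| + 1) * (eps * h) <= rho / 2 * h.
  rewrite mulrA ler_pM2r//.
  have : eps <= rho / (2 * (`|q| + 1)) by rewrite ge_min lexx orbT.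
  by rewrite ler_pdivlMr ?mulr_gt0//; clear; lra.
have T6 : 0 < rho * h by rewrite mulr_gt0.
by clear -T1 T2 T3 T4 T5 T6; lra.
Qed.

(** The projection of a boundary point to x_1 = a lies in K by condition (ii), and by condition (i)
    so does the segment joining them. Thus g <= 0 from x towards a while g x = 0, and g cannot
    increase at first order in that direction. *)
Lemma dir_convex_grad {R : realType} {n : nat} (K : set 'rV[R]_n.+2) (g : 'rV[R]_n.+2 -> R)
    (G : R) :
  K = [set x | g x <= 0] ->
  (forall (l : seq 'I_n.+2) (k : 'I_n.+2 -> R) y,
    `|g (y + \sum_(j <- l) k j *: e_ R j) - g y - \sum_(j <- l) 'D_(e_ R j) g y * k j|
      <= G * (\sum_(j <- l) `|k j|) ^+ 2) ->
  dir_convex_x1 K ->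
  exists a : R, forall x, g x = 0 -> 0 <= (x 0 0 - a) * 'D_(e_ R 0) g x.
Proof.
move=> KE gT [a [cvx proj]]; exists a => x gx.
have setx1E (s : R) : setx1 x s = x + (s - x 0 0) *: e_ R 0.
  apply/rowP => j; rewrite mxE add_e_coord; case: eqP => [->|_].
    by rewrite mulr1 addrC subrK.
  by rewrite mulr0 addr0.
have Kx : K x by rewrite KE /= gx.
have Ka : K (setx1 x a).
  have : [set x | x1 x = a /\ exists s, K (setx1 x s)] (setx1 x a).
    split; first by rewrite /x1 mxE.
    exists (x 0 0); suff -> : setx1 (setx1 x a) (x 0 0) = x by [].
    by apply/rowP => j; rewrite !mxE; case: eqP => [->|].
  by rewrite -proj => -[].
have Kxx : K (setx1 x (x 0 0)) by rewrite setx1E subrr scale0r addr0.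
have [p [q [_ pq]]] : exists p q : R, p <= q /\ [set s | K (setx1 x s)] = [set s | p <= s <= q].
  by case: (cvx x) => // E; have : [set s | K (setx1 x s)] a by []; rewrite E.
have /andP[pa aq] : p <= a <= q by have : [set s | K (setx1 x s)] a by []; rewrite pq.
have /andP[px xq] : p <= x 0 0 <= q.
  by have : [set s | K (setx1 x s)] (x 0 0) by []; rewrite pq.
have neg (r : R) : p <= x 0 0 + r <= q -> r * 'D_(e_ R 0) g x <= G * r ^+ 2.
  move=> hr; have : K (setx1 x (x 0 0 + r)).
    by have : [set s | K (setx1 x s)] (x 0 0 + r) by rewrite pq.
  rewrite setx1E addrAC subrr add0r KE /= => gr.
  have := gT [:: 0] (fun=> r) x; rewrite !big_seq1 gx subr0 ler_norml real_normK ?num_real//.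
  by move: (g _) gr (G * _) => b1 b2 b3 /andP[b4 _]; clear -b2 b4; lra.
set D := 'D_(e_ R 0) g x in neg *; set X := x 0 0 - a.
rewrite leNgt; apply/negP => XD.
have X0 : X != 0 by apply/eqP => X0; move: XD; rewrite X0 mul0r ltxx.
(* If X D < 0, a step - h X towards a raises g by - h X D up to a quadratic error, so it leaves K
   for small h. *)
have [d d0 Hd] := quadratic_small (- (X * D)) (`|G| * X ^+ 2)
   ltac:(by rewrite oppr_gt0) ltac:(by rewrite mulr_ge0 ?sqr_ge0).
pose h := Num.min d 1 / 2.
have m0 : 0 < Num.min d 1 by rewrite lt_min d0 ltr01.
have h0 : 0 < h by rewrite divr_gt0.
have : h < Num.min d 1 by rewrite /h; clear -m0; lra.
rewrite lt_min => /andP[hd h1].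
have := Hd h; rewrite h0 hd => /(_ isT) H1.
have : - (h * X) * D <= G * (- (h * X)) ^+ 2.
  apply: neg; rewrite /X.
  have -> : x 0 0 - h * (x 0 0 - a) = (1 - h) * x 0 0 + h * a by ring.
  by clear -px xq pa aq h0 h1; apply/andP; split; nra.
have : G * (h * X) ^+ 2 <= `|G| * X ^+ 2 * h ^+ 2.
  by rewrite exprMn mulrCA [leRHS]mulrC ler_wpM2l ?sqr_ge0// ler_wpM2r ?sqr_ge0// ler_norm.
rewrite sqrrN; clear -H1; lra.
Qed.

(** Here E / L^2 is theta, and w bounds the deviation of the gradient of the barrier from a unit
    vector. First w is fixed by the gradient and curvature budgets, then mu = w / (2 G), and L comes
    last: it makes the lateral slope at most w / 2 and keeps the lateral loss on the boundary below
    the inward growth mu delta^2. *)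
Lemma barrier_constants {R : realType} (N G E q0 kap Ch delta : R) :
  0 < N -> 0 < G -> 0 < E -> 0 < q0 -> 0 < kap -> 0 < Ch -> 0 < delta ->
  exists mu L w : R, [/\ 0 < mu, 0 < L, 0 < w <= 1, mu * G + 2 * (E / L ^+ 2) * L <= w &
    [/\ Ch * ((3 + N) * w) <= kap / 4, 2 * (N * (mu * G + E / L ^+ 2)) <= q0 * kap / 4 &
     2 * (E / L ^+ 2) * L * N * G < mu * delta ^+ 2]].
Proof.
move=> N0 G0 E0 q00 kap0 Ch0 delta0.
have b1 : 0 < kap / (4 * Ch * (3 + N)) by rewrite divr_gt0// !mulr_gt0// addr_gt0.
have b2 : 0 < q0 * kap / (8 * N) by rewrite divr_gt0 ?mulr_gt0.
pose w := Num.min 1 (Num.min (kap / (4 * Ch * (3 + N))) (q0 * kap / (8 * N))).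
have w0 : 0 < w by rewrite !lt_min ltr01 b1.
have w1 : w <= 1 by rewrite ge_min lexx.
have w2 : w * (4 * Ch * (3 + N)) <= kap.
  rewrite -ler_pdivlMr ?mulr_gt0 ?addr_gt0//.
  by rewrite /w minA ge_min; apply/orP; left; rewrite ge_min lexx orbT.
have w3 : w * (8 * N) <= q0 * kap.
  by rewrite -ler_pdivlMr ?mulr_gt0// /w minA ge_min lexx orbT.
pose mu := w / (2 * G).
have mu0 : 0 < mu by rewrite divr_gt0 ?mulr_gt0.
have muG : mu * G = w / 2 by rewrite /mu; field; rewrite gt_eqF.
pose L := 4 * E / w + 4 * E * N * G / (mu * delta ^+ 2) + 1.
have l1 : 0 < 4 * E / w by rewrite divr_gt0 ?mulr_gt0.
have md0 : 0 < mu * delta ^+ 2 by rewrite mulr_gt0 ?exprn_gt0.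
have l2 : 0 < 4 * E * N * G / (mu * delta ^+ 2) by rewrite divr_gt0// !mulr_gt0.
have L1 : 1 < L by rewrite /L; clear -l1 l2; lra.
have L0 : 0 < L by clear -L1; lra.
have EL : 4 * (E / L) <= w.
  have : 4 * E / w <= L by rewrite /L; clear -l2; lra.
  by rewrite ler_pdivrMr// => h; rewrite mulrA ler_pdivrMr// [w * L]mulrC.
have EL2 : 4 * E * N * G <= L * (mu * delta ^+ 2).
  by rewrite -ler_pdivrMr// /L; clear -l1; lra.
have ELL : E / L ^+ 2 * L = E / L by field; rewrite gt_eqF.
have ELE : E / L ^+ 2 <= E / L.
  by rewrite ler_pM2l// lef_pV2 ?posrE ?exprn_gt0// expr2 ler_peMl ?ltW.
have EL0 : 0 < E / L by rewrite divr_gt0.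
exists mu, L, w; split => //; first by rewrite w0.
  by rewrite muG -mulrA ELL; clear -EL EL0; lra.
split.
- by clear -w2; lra.
- have : N * (mu * G + E / L ^+ 2) <= N * w by rewrite ler_pM2l// muG; clear -EL ELE w0; lra.
  by clear -w3; lra.
- have -> : 2 * (E / L ^+ 2) * L * N * G = 2 * E * N * G / L by field; rewrite gt_eqF.
  rewrite ltr_pdivrMr// [ltRHS]mulrC.
  have : 0 < E * N * G by rewrite !mulr_gt0.
  by clear -EL2; lra.
Qed.

Lemma sum_sqr_near1 {R : realType} {n : nat} (p : 'I_n.+2 -> R) (s w : R) : 0 <= w <= 1 ->
  s ^+ 2 = 1 -> `|p 0 - s| <= w -> (forall j, j != 0 -> `|p j| <= w) ->
  `|\sum_j p j ^+ 2 - 1| <= (3 + n.+2%:R) * w.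
Proof.
move=> /andP[w0 w1] s1 ps pj; rewrite (bigD1 0)//=.
have sq (y : R) : `|y| <= w -> y ^+ 2 <= w.
  move=> yw; rewrite -real_normK ?num_real// expr2.
  have := normr_ge0 y; move: `|y| yw => z; clear -w1; nra.
have h1 : 0 <= \sum_(j < n.+2 | j != 0) p j ^+ 2 by apply: sumr_ge0 => j _; exact: sqr_ge0.
have h2 : \sum_(j < n.+2 | j != 0) p j ^+ 2 <= n.+2%:R * w.
  apply: (le_trans (_ : _ <= \sum_(j < n.+2) w)).
    rewrite [leRHS](bigD1 0)//= -[leLHS]add0r lerD// ler_sum// => j /pj; exact: sq.
  by rewrite sumr_const card_ord mulr_natl.
have sn : `|s| = 1 by rewrite -sqrtr_sqr s1 sqrtr1.
have h3 : p 0 ^+ 2 = 1 + 2 * (s * (p 0 - s)) + (p 0 - s) ^+ 2.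
  rewrite [RHS](_ : _ = p 0 ^+ 2 + (1 - s ^+ 2)); last by ring.
  by rewrite s1 subrr addr0.
have h4 : `|s * (p 0 - s)| <= w by rewrite normrM sn mul1r.
have h5 := sq _ ps; have h6 := sqr_ge0 (p 0 - s).
rewrite h3; move: h1 h2 h4 h5 h6; move: (\sum_(j | _) _) (s * _) (_ ^+ 2) => a1 a2 a3.
by rewrite !ler_norml => h1 h2 h4 h5 h6; clear -h1 h2 h4 h5 h6 w0; lra.
Qed.

Lemma box_margin {R : realType} {n : nat} (lo hi : 'I_n.+2 -> R) (z : 'rV[R]_n.+2) :
  (forall j, lo j < z 0 j < hi j) ->
  exists2 r : R, 0 < r & forall y : 'rV[R]_n.+2, (forall j, `|y 0 j - z 0 j| <= r) ->
    forall j, lo j <= y 0 j <= hi j.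
Proof.
move=> H.
pose r := \big[Num.min/1]_j Num.min (z 0 j - lo j) (hi j - z 0 j).
have rj j : r <= Num.min (z 0 j - lo j) (hi j - z 0 j) by apply: bigmin_le_cond.
exists r.
  apply: lt_bigmin => // j _; have := H j; rewrite lt_min !subr_gt0 => /andP[-> ->] //.
move=> y yz j; have := le_trans (yz j) (rj j); rewrite le_min !ler_norml.
by clear; lra.
Qed.

Lemma grad_inward {R : realType} {n : nat} (g : 'rV[R]_n.+2 -> R) (G delta : R)
    (x : 'rV[R]_n.+2) :
  (forall y i, `|'D_(e_ R i) g y| <= G) ->
  (forall (l : seq 'I_n.+2) (k : 'I_n.+2 -> R) y,
    `|g (y + \sum_(j <- l) k j *: e_ R j) - g y - \sum_(j <- l) 'D_(e_ R j) g y * k j|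
      <= G * (\sum_(j <- l) `|k j|) ^+ 2) ->
  0 < delta -> delta <= `|grad g x| -> g x = 0 ->
  exists2 d : R, 0 < d & forall h : R, 0 < h < d -> 0 < g (x + h *: grad g x).
Proof.
move=> gG gT d0 dx gx.
have G0 : 0 <= G by apply: le_trans (gG x 0).
have S0 : 0 < \sum_j ('D_(e_ R j) g x) ^+ 2.
  by apply: lt_le_trans (grad_sum_sqr g x delta d0 dx); exact: exprn_gt0.
have [d dd Hd] := quadratic_small _ (G * (n.+2%:R * G) ^+ 2) S0
   ltac:(by rewrite mulr_ge0 ?sqr_ge0).
exists d => // h hd; have /andP[h0 _] := hd.
apply: lt_le_trans (grad_taylor g G x gG gT h (ltW h0)).
by rewrite gx add0r subr_gt0 [ltRHS]mulrC; exact: Hd.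
Qed.

Lemma nonneg_closure {R : realType} {n : nat} (K : set 'rV[R]_n.+2) (g : 'rV[R]_n.+2 -> R)
    (x y : 'rV[R]_n.+2) (d : R) :
  K = [set x | g x <= 0] -> 0 < d -> (forall h : R, 0 < h < d -> 0 < g (x + h *: y)) ->
  closure (~` K) x.
Proof.
move=> KE d0 H W nW.
have : x + h *: y @[h --> (0 : R)] --> x + (0 : R) *: y.
  by apply: cvgD; [exact: cvg_cst|apply: cvgZr_tmp; exact: cvg_id].
rewrite scale0r addr0 => /(_ W nW) /nbhs_ballP [r /= r0 Hr].
pose h := Num.min d r / 2.
have m0 : 0 < Num.min d r by rewrite lt_min d0.
have h0 : 0 < h by rewrite divr_gt0.
have : h < Num.min d r by rewrite /h; clear -m0; lra.
rewrite lt_min => /andP[hd hr].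
exists (x + h *: y); split.
  by rewrite KE; apply/negP; rewrite -ltNge H// h0.
by apply: Hr; rewrite /ball /= sub0r normrN gtr0_norm.
Qed.

(** The bounds in [entire_solution] concern points off K. On the boundary they pass to the limit
    along the inward ray, where the Neumann quotient forces the values of w to converge, and so
    become non-strict. *)
Lemma boundary_range {R : realType} {n : nat} (w : 'rV[R]_n.+2 -> R) (x y : 'rV[R]_n.+2) (d : R) :
  (fun h => (w (x + h *: y) - w x) / h) @ 0^'+ --> 0 -> 0 < d ->
  (forall h : R, 0 < h < d -> 0 < w (x + h *: y) < 1) -> 0 <= w x <= 1.
Proof.
move=> nw d0 H; have [d1 d10 H1] := neumann_approx w x y nw 1 ltr01.
have key (e : R) : 0 < e -> - e < w x < 1 + e.
  move=> e0; pose h := Num.min (Num.min d d1) e / 2.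
  have m0 : 0 < Num.min (Num.min d d1) e by rewrite !lt_min d0 d10.
  have h0 : 0 < h by rewrite divr_gt0.
  have : h < Num.min (Num.min d d1) e by rewrite /h; clear -m0; lra.
  rewrite !lt_min => /andP[/andP[hd hd1] he].
  have := H h; rewrite h0 hd => /(_ isT).
  have := H1 h; rewrite h0 hd1 => /(_ isT); rewrite ler_norml mul1r.
  by move: (w _) (w x) => b1 b2; clear -he; lra.
apply/andP; split.
  by rewrite leNgt; apply/negP => wn; have := key (- w x); rewrite oppr_gt0 => /(_ wn); clear; lra.
rewrite leNgt; apply/negP => wn; have := key (w x - 1); rewrite subr_gt0 => /(_ wn); clear; lra.
Qed.

(** * Sweeping the slab *)

(** The barrier starts below -1, hence below Th(u) >= 0, and rises by E at speed q0 kap / 4. It ends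
    at least at Th(1 - 2e) at [xs] without exceeding E - 1 < Th(1 - e) anywhere. Each type of first
    contact is excluded: slab faces by [lat], lateral faces by theta, the wall by the Neumann
    condition, and interior points by the contact inequality. *)
Lemma middle_state {R : realType} {n : nat} (f Th q h : R -> R) (e kap q0 Ch : R)
    (K : set 'rV[R]_n.+2) (g : 'rV[R]_n.+2 -> R) (u : R -> 'rV[R]_n.+2 -> R)
    (G delta a A mu L w T0 : R) (xs : 'rV[R]_n.+2) :
  wave_profile f Th q h (1 - e) kap q0 Ch ->
  [/\ 0 < kap, 0 < q0, 0 < Ch, 0 < e & 4 * e < 1] ->
  entire_solution f K g u -> K = [set x | g x <= 0] ->
  [/\ 0 < G, forall x, `|g x| <= G, forall x i, `|'D_(e_ R i) g x| <= G, continuous g &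
   forall (l : seq 'I_n.+2) (k : 'I_n.+2 -> R) x,
    `|g (x + \sum_(j <- l) k j *: e_ R j) - g x - \sum_(j <- l) 'D_(e_ R j) g x * k j|
      <= G * (\sum_(j <- l) `|k j|) ^+ 2] ->
  0 < delta -> (forall x, g x = 0 -> delta <= `|grad g x|) ->
  (forall x, g x = 0 -> 0 <= (x 0 0 - a) * 'D_(e_ R 0) g x) ->
  0 <= A -> A + 2 <= Th (1 - e) - Th (1 - 2 * e) ->
  let E := A + 2 + Th (1 - 2 * e) in
  [/\ 0 < mu, 0 < L, 0 < w <= 1, mu * G + 2 * (E / L ^+ 2) * L <= w &
    [/\ Ch * ((3 + n.+2%:R) * w) <= kap / 4,
     2 * (n.+2%:R * (mu * G + E / L ^+ 2)) <= q0 * kap / 4 &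
     2 * (E / L ^+ 2) * L * n.+2%:R * G < mu * delta ^+ 2]] ->
  `|xs 0 0 - a| <= A -> 0 < g xs ->
  (forall (t : R) (x : 'rV[R]_n.+2), T0 <= t -> `|x 0 0 - a| = A ->
    (forall j, j != 0 -> `|x 0 j - xs 0 j| <= L) -> 1 - e <= u t x) ->
  1 - 2 * e < u (T0 + E / (q0 * kap / 4)) xs.
Proof.
move=> wp [kap0 q00 Ch0 e0 e4] sol KE [G0 gG dgG cg gT] delta0 gdel gdir A0 ThA E.
have EE : E = A + 2 + Th (1 - 2 * e) by [].
move: E EE => E EE [mu0 L0 /andP[w0 w1] hw [c1 c2 c3]] xsA gxs lat.
rewrite ltNge; apply/negP => bad.
have [sg sgE] : exists sg : R, sg = q0 * kap / 4 by exists (q0 * kap / 4).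
rewrite -sgE in bad c2.
have sg0 : 0 < sg by rewrite sgE divr_gt0// mulr_gt0.
have [th thE] : exists th : R, th = E / L ^+ 2 by exists (E / L ^+ 2).
rewrite -thE in hw c2 c3.
have [dTh qq0 Th0 dq] := wp.
have e1 : 0 <= 1 - 2 * e by clear -e4 e0; lra.
have Thlt (s s' : R) : 0 <= s' -> s <= 1 -> Th s < Th s' -> s < s'.
  exact: (wave_profile_lt f Th q h _ kap q0 Ch wp (ltW q00)).
have Thle (s s' : R) : 0 <= s -> s <= s' -> s' <= 1 -> Th s <= Th s'.
  move=> s0 ss' s1; have := wave_profile_incr f Th q h _ kap q0 Ch wp s s' s0 ss' s1.
  by move=> H; rewrite -subr_ge0; apply: le_trans H; rewrite mulr_ge0 ?(ltW q00)// subr_ge0.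
have Thb0 : 0 <= Th (1 - 2 * e) by rewrite -Th0; apply: Thle => //; clear -e0; lra.
have E0 : 0 < E by rewrite EE; clear -A0 Thb0; lra.
have th0 : 0 < th by rewrite thE divr_gt0// exprn_gt0.
have thL : th * L ^+ 2 = E by rewrite thE divfK// gt_eqF// exprn_gt0.
have muG : mu * G <= 1.
  have : 0 < 2 * th * L by rewrite !mulr_gt0.
  by clear -hw w1; lra.
have [_ [du [_ [_ [pde [neu u01]]]]]] := sol.
have OK x : 0 < g x -> (~` K) x by move=> gx; rewrite KE; apply/negP; rewrite -ltNge.
have reg x : 0 <= g x -> closure (~` K) x /\ forall t, 0 <= u t x <= 1.
  rewrite le_eqVlt => /predU1P[/esym gx|gx]; last first.
    split=> [|t]; first exact: (subset_closure_point _ _ (OK x gx)).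
    by have := u01 t x (OK x gx); clear; lra.
  have [d d0 Hd] := grad_inward g G delta x dgG gT delta0 (gdel x gx) gx.
  split=> [|t]; first exact: (nonneg_closure K g x _ d KE d0 Hd).
  apply: (boundary_range (u t) x _ d (neu t x gx) d0) => r hr.
  by apply: u01; apply: OK; exact: Hd.
pose Q (x : 'rV[R]_n.+2) := \sum_(j | j != 0) (x 0 j - xs 0 j) ^+ 2.
pose lo j := if j == 0 then a - A else xs 0 j - L.
pose hi j := if j == 0 then a + A else xs 0 j + L.
pose D := [set x : 'rV[R]_n.+2 | (forall j, lo j <= x 0 j <= hi j) /\ 0 <= g x].
have Da x : D x -> `|x 0 0 - a| <= A.
  by move=> [/(_ 0)]; rewrite /lo /hi eqxx ler_norml; clear; lra.
have Dj x j : D x -> j != 0 -> `|x 0 j - xs 0 j| <= L.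
  by move=> [/(_ j) + _] /negbTE j0; rewrite /lo /hi j0 ler_norml; clear; lra.
have cD : compact D.
  apply: compact_closedI; first exact: compact_box.
  by apply: (@closed_comp _ _ g [set y | 0 <= y]); [move=> x _; exact: cg|exact: closed_ge].
(* The shift A + 2 pays for |x_1 - a| <= A and mu g <= 1, with a margin of 1 for strictness. *)
pose xi (x : 'rV[R]_n.+2) := `|x 0 0 - a| + mu * g x - th * Q x - (A + 2).
have cxi : continuous xi.
  move=> x; apply: (@cvgB _ _ _ (nbhs x)); last exact: cvg_cst.
  apply: (@cvgB _ _ _ (nbhs x)).
    apply: (@cvgD _ _ _ (nbhs x)).
      apply: (@continuous_comp _ _ _ (fun y : 'rV[R]_n.+2 => y 0 0) (fun r => `|r - a|)).
        exact: continuous_coord.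
      by apply: cvg_norm; apply: cvgB; [exact: cvg_id|exact: cvg_cst].
    apply: (@continuous_comp _ _ _ g (fun r => mu * r)); first exact: cg.
    by apply: cvgM; [exact: cvg_cst|exact: cvg_id].
  apply: (@continuous_comp _ _ _ Q (fun r => th * r)); first exact: continuous_sum_sqr.
  by apply: cvgM; [exact: cvg_cst|exact: cvg_id].
pose zeta (p : R * 'rV[R]_n.+2) := xi p.2 + sg * (p.1 - T0).
pose k (p : R * 'rV[R]_n.+2) := Th (u p.1 p.2) - zeta p.
pose T1 := T0 + E / sg.
have ck : {within `[T0, T1] `*` D, continuous k}.
  apply: within_continuousB.
    apply: (within_continuous_transform f Th q K g) => //.
    - by move=> x [_ /reg[]].
    - by move=> t x [_ /reg[]].
  apply: continuous_subspaceT => p; apply: cvgD.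
    by apply: (@continuous_comp _ _ _ snd xi); [exact: cvg_snd|exact: cxi].
  by apply: cvgM; [exact: cvg_cst|apply: cvgB; [exact: cvg_fst|exact: cvg_cst]].
have Q0 x : 0 <= Q x by apply: sumr_ge0 => j _; exact: sqr_ge0.
have xile x : D x -> xi x <= - 1 - th * Q x.
  move=> Dx; have := Da x Dx; have : mu * g x <= mu * G.
    by rewrite ler_pM2l// (le_trans (ler_norm _)).
  by rewrite /xi; move: `|_| (mu * g x) (th * Q x) => b1 b2 b3; clear -muG; lra.
have sgT t : T0 <= t <= T1 -> 0 <= sg * (t - T0) <= E.
  move=> /andP[t0 t1]; rewrite mulr_ge0 ?subr_ge0 ?(ltW sg0)//=.
  by rewrite mulrC -ler_pdivlMr// lerBlDl.
have ThE : E - 1 < Th (1 - e) by rewrite EE; clear -ThA; lra.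
have thQ0 x : 0 <= th * Q x by rewrite mulr_ge0// ltW.
have Th_ge0 t x : D x -> 0 <= Th (u t x).
  by move=> [_ /reg[_ /(_ t)/andP[h1 h2]]]; rewrite -Th0; exact: Thle.
case: (compact_first_zero D T0 T1 k cD ck).
- move=> x Dx; rewrite /k /zeta /= subrr mulr0 addr0 subr_gt0.
  apply: (lt_le_trans _ (Th_ge0 T0 x Dx)); apply: (le_lt_trans (xile x Dx)).
  by have := thQ0 x; clear; lra.
- exists T1, xs; split.
  + by rewrite lexx andbT lerDl divr_ge0// ltW.
  + split; last exact: ltW.
    move=> j; rewrite /lo /hi; case: eqP => [->|_].
      by move: xsA; rewrite ler_norml; clear; lra.
    by clear -L0; lra.
  + have Qs : Q xs = 0 by rewrite /Q big1// => j _; rewrite subrr expr0n.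
    have sgT1 : sg * (T1 - T0) = E by rewrite /T1 [T0 + _]addrC addrK mulrC divfK ?gt_eqF.
    rewrite /k /zeta /xi /= Qs mulr0 subr0 sgT1.
    have : Th (u T1 xs) <= Th (1 - 2 * e).
      apply: Thle => //; last by clear -e0; lra.
      by have [_ /(_ T1)/andP[]] := reg xs (ltW gxs).
    have : 0 <= mu * g xs by rewrite mulr_ge0// ltW.
    have := normr_ge0 (xs 0 0 - a).
    by rewrite EE; move: `|_| (mu * _) (Th (u _ _)) => b1 b2 b3; clear; lra.
move=> t [z [/andP[T0t tT1] Dz kz kge kpos]].
have sgt := sgT t ltac:(by rewrite (ltW T0t)).
have kzE : Th (u t z) = zeta (t, z) by apply/eqP; rewrite -subr_eq0; exact/eqP.
have [_ gz0] := Dz.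
have [_ /(_ t) uz] := reg z gz0.
have ThuE : Th (u t z) < Th (1 - e).
  rewrite kzE /zeta /=; apply: le_lt_trans ThE; have := xile z Dz; have := thQ0 z.
  by move: (xi z) (th * _) (sg * _) sgt => b1 b2 b3; clear; lra.
have zin j : lo j < z 0 j < hi j.
  have [/(_ j) zj _] := Dz.
  suff : z 0 j != lo j /\ z 0 j != hi j.
    by move: zj; rewrite !lt_neqAle eq_sym => /andP[-> ->] [-> ->].
  suff bd : z 0 j = lo j \/ z 0 j = hi j -> False.
    by split; apply/eqP => zE; apply: bd; [left|right].
  move=> bd; have [j0|j0] := eqVneq j 0.
    have zA : `|z 0 0 - a| = A.
      rewrite -j0; case: bd => ->; rewrite /lo /hi j0 eqxx.
        by rewrite addrAC subrr add0r normrN ger0_norm.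
      by rewrite addrAC subrr add0r ger0_norm.
    have := lat t z (ltW T0t) zA (fun j => Dj z j Dz) => ue.
    have := Thle (1 - e) (u t z) ltac:(clear -e4 e0; lra) ue ltac:(by case/andP: uz).
    by rewrite leNgt ThuE.
  have zL : (z 0 j - xs 0 j) ^+ 2 = L ^+ 2.
    case: bd => ->; rewrite /lo /hi (negbTE j0).
      by rewrite addrAC subrr add0r sqrrN.
    by rewrite addrAC subrr add0r.
  (* On a lateral face theta L^2 = E cancels the whole rise of the barrier, which stays negative
     there. *)
  have QL : E <= th * Q z.
    rewrite -thL ler_pM2l// -zL /Q (bigD1 j)//= lerDl sumr_ge0// => l _; exact: sqr_ge0.
  have := Th_ge0 t z Dz; rewrite kzE /zeta /=; have := xile z Dz.
  by move: (xi z) (th * _) (sg * _) sgt QL => b1 b2 b3; clear; lra.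
have [r r0 Hr] := box_margin lo hi z zin.
have zetaB x : zeta (t, x) - zeta (t, z) = (`|x 0 0 - a| - `|z 0 0 - a|)
    + mu * (g x - g z) - th * (Q x - Q z).
  by rewrite /zeta /xi /=; clear; ring.
have kge' x : D x -> Th (u t z) + (zeta (t, x) - zeta (t, z)) <= Th (u t x).
  by move=> /kge; rewrite /k /= subr_ge0 kzE addrC subrK.
have [gz|gz] : g z = 0 \/ 0 < g z.
  by move: gz0; rewrite le_eqVlt => /predU1P[->|]; [left|right].
- have [d1 d10 Hd1] := grad_inward g G delta z dgG gT delta0 (gdel z gz) gz.
  have S2 := grad_sum_sqr g z delta delta0 (gdel z gz).
  have tay := grad_taylor g G z dgG gT.
  move: (\sum_i _ ^+ 2) S2 tay => S S2 tay.
  have [N NE] : exists N : R, N = n.+2%:R by exists n.+2%:R.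
  rewrite -NE in tay c3.
  have N0 : 0 <= N by rewrite NE.
  (* Along the gradient of g, the term mu g grows at rate mu S, and the lateral term loses at most 2
     theta L N G. Half of the difference is kept as the strict rate, and the other half absorbs the
     quadratic remainders. *)
  have c0 : 0 < (mu * S - 2 * th * L * N * G) / 2.
    have : mu * delta ^+ 2 <= mu * S by rewrite ler_pM2l.
    by move=> H; rewrite divr_gt0//; clear -c3 H; lra.
  have b0 : 0 <= mu * (G * (N * G) ^+ 2) + th * (N * G ^+ 2).
    by rewrite addr_ge0// !mulr_ge0 ?sqr_ge0// ltW.
  have [d2 d20 Hd2] := quadratic_small _ _ c0 b0.
  have rG : 0 < r / G by rewrite divr_gt0.
  apply: (neumann_no_touch (u t) z (grad g z) Th (q (u t z))
     ((mu * S - 2 * th * L * N * G) / 2) (Num.min (Num.min d1 d2) (r / G)) (neu t z gz)) => //.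
  + by apply: dTh; move: uz; clear; lra.
  + by rewrite !lt_min d10 d20.
  move=> l /andP[l0]; rewrite !lt_min => /andP[/andP[l1 l2] l3].
  have coordE j : (z + l *: grad g z) 0 j = z 0 j + l * 'D_(e_ R j) g z by rewrite !mxE.
  have gl : 0 < g (z + l *: grad g z) by apply: Hd1; rewrite l0.
  have Dl : D (z + l *: grad g z).
    split; last exact: ltW.
    apply: Hr => j; rewrite coordE addrAC subrr add0r normrM gtr0_norm//.
    apply: (le_trans (_ : _ <= l * G)); first by rewrite ler_pM2l.
    by rewrite -ler_pdivlMr// ltW.
  apply: le_trans (kge' _ Dl); rewrite lerD2l zetaB gz subr0.
  have abs : `|z 0 0 - a| <= `|(z + l *: grad g z) 0 0 - a|.
    rewrite coordE addrAC -ler_sqr ?nnegrE// !real_normK ?num_real//.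
    have := gdir z gz; rewrite -(pmulr_rge0 _ l0).
    move: (z 0 0 - a) ('D__ _ _) => X Y; have := sqr_ge0 (l * Y).
    by clear; lra.
  have QB : Q (z + l *: grad g z) - Q z <= N * (2 * L * G * l + G ^+ 2 * l ^+ 2).
    rewrite /Q -sumrB; apply: (le_trans (_ : _ <= \sum_(j < n.+2) (2 * L * G * l + G ^+ 2 * l ^+ 2))).
      rewrite [leRHS](bigD1 0)//= -[leLHS]add0r lerD//.
        by rewrite addr_ge0// !mulr_ge0 ?sqr_ge0// ltW.
      apply: ler_sum => j j0; rewrite coordE.
      have zL := Dj z j Dz j0; have DG := dgG z j.
      have -> : (z 0 j + l * 'D_(e_ R j) g z - xs 0 j) ^+ 2 - (z 0 j - xs 0 j) ^+ 2 =
          2 * ((z 0 j - xs 0 j) * 'D_(e_ R j) g z) * l + ('D_(e_ R j) g z) ^+ 2 * l ^+ 2.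
        by clear; ring.
      apply: lerD.
        rewrite ler_pM2r// -!mulrA ler_pM2l// (le_trans (ler_norm _))// normrM.
        by apply: ler_pM.
      rewrite ler_wpM2r ?sqr_ge0// -real_normK ?num_real//.
      by rewrite lerXn2r ?nnegrE// ltW.
    by rewrite sumr_const card_ord NE [leRHS]mulr_natl.
  have T1' := tay l (ltW l0).
  have {Hd2} := Hd2 l; rewrite l0 l2 => /(_ isT) Hd2.
  rewrite gz add0r in T1'.
  have T2 : mu * (l * S - G * (N * G) ^+ 2 * l ^+ 2) <= mu * g (z + l *: grad g z).
    by rewrite ler_pM2l.
  have T3 : th * (Q (z + l *: grad g z) - Q z) <= th * (N * (2 * L * G * l + G ^+ 2 * l ^+ 2)).
    by rewrite ler_pM2l.
  move: abs T2 T3; move: `|_| `|_| (mu * g _) (th * (_ - _)) => b1 b2 b3 b4 abs T2 T3.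
  by clear -abs T2 T3 Hd2; lra.
- have zK := OK z gz.
  have uz' := u01 t z zK.
  have [dt dx] := du t z zK.
  (* By convexity |x_1 - a| has a supporting line of slope 1 or -1 at every point, so the kink needs
     no separate treatment in a test from below. *)
  have [s0 s0E sabs] : exists2 s0 : R, s0 ^+ 2 = 1 &
      forall s : R, s0 * s <= `|z 0 0 + s - a| - `|z 0 0 - a|.
    have [za|za] := leP 0 (z 0 0 - a).
      exists 1; first by rewrite expr1n.
      move=> s; rewrite (ger0_norm za); have := ler_norm (z 0 0 + s - a).
      by move: `|_| => b1; clear; lra.
    exists (-1); first by rewrite sqrrN expr1n.
    move=> s; rewrite (ltr0_norm za); have := lerNnormlW (lexx `|z 0 0 + s - a|).
    by move: `|_| => b1; clear; lra.
  pose p j := (if j == 0 then s0 else - (2 * th * (z 0 j - xs 0 j))) + mu * 'D_(e_ R j) g z.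
  (* Steps of this size stay in the box, keep g > 0 and remain after T0; the bound 1 is there for
     s^2 <= |s|. *)
  pose ein := Num.min (Num.min 1 r) (Num.min (g z / (2 * G)) (t - T0)).
  (* The curvature allowance mu G + theta collects the Taylor remainder of mu g and the exact
     quadratic part of the lateral term. *)
  have touch : q (u t z) * (f (u t z) + h (u t z) * \sum_j p j ^+ 2)
      <= sg + 2 * \sum_(j < n.+2) (mu * G + th).
    apply: (interior_touch f Th q h _ kap q0 Ch u t z p (fun=> mu * G + th) sg ein wp q00 dt
      (pde t z zK)).
    + case/andP: uz' => -> u1 /=; apply/ltW; apply: (Thlt _ _ _ (ltW u1) ThuE).
      by clear -e4 e0; lra.
    + by rewrite !lt_min ltr01 r0 subr_gt0 T0t divr_gt0// mulr_gt0.
    + move=> i s; rewrite !lt_min => /andP[/andP[s1 sr] /andP[sgz _]].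
      have sG : 2 * G * `|s| < g z by rewrite mulrC -ltr_pdivlMr ?mulr_gt0.
      have s2 : s ^+ 2 <= `|s|.
        by rewrite -real_normK ?num_real// expr2 ler_piMr// ltW.
      have tay : g z + 'D_(e_ R i) g z * s - G * s ^+ 2 <= g (z + s *: e_ R i).
        have := gT [:: i] (fun=> s) z; rewrite !big_seq1 real_normK ?num_real// ler_norml.
        by move: (g _) (_ * s) (g z) (G * _) => b1 b2 b3 b4; clear; lra.
      have gs : 0 < g (z + s *: e_ R i).
        apply: lt_le_trans tay.
        have h1 : - (G * `|s|) <= 'D_(e_ R i) g z * s.
          by rewrite lerNl (le_trans (ler_norm _))// normrN normrM ler_wpM2r.
        have h2 : G * s ^+ 2 <= G * `|s| by rewrite ler_pM2l.
        move: h1 h2 sG; move: (g z) (_ * s) (_ * _ ^+ 2) (`|s|) => b1 b2 b3 b4.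
        by clear; lra.
      have Ds : D (z + s *: e_ R i).
        split; last exact: ltW.
        apply: Hr => j; rewrite add_e_coord addrAC subrr add0r normrM.
        by case: (j == i); rewrite ?normr1 ?normr0 ?mulr1 ?mulr0 ltW.
      have sK := OK _ gs; have [_ /(_ i)[du1 _]] := du t _ sK.
      split; [exact: du1|exact: u01|].
      apply: le_trans (kge' _ Ds); rewrite -addrA lerD2l zetaB.
      have mg : mu * ('D_(e_ R i) g z * s - G * s ^+ 2) <= mu * (g (z + s *: e_ R i) - g z).
        rewrite ler_pM2l//; move: tay; move: (g _) (_ * s) (g z) (G * _) => b1 b2 b3 b4.
        by clear; lra.
      have [i0|i0] := eqVneq i 0.
        have QE : Q (z + s *: e_ R i) = Q z.
          apply: eq_bigr => j j0; rewrite add_e_coord i0 (negbTE j0) mulr0 addr0 //.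
        rewrite QE subrr mulr0 subr0 add_e_coord i0 eqxx mulr1 /p eqxx.
        rewrite i0 in mg; have := sabs s; have : 0 <= th * s ^+ 2.
          by rewrite mulr_ge0 ?sqr_ge0// ltW.
        move: mg; move: ('D__ _ _) (g (z + _) - _) (_ - `|z 0 0 - a|) => b1 b2 b3.
        by clear; lra.
      have QE : Q (z + s *: e_ R i) - Q z = 2 * (z 0 i - xs 0 i) * s + s ^+ 2.
        rewrite /Q (bigD1 i)//= [X in _ - X](bigD1 i)//= add_e_coord eqxx mulr1.
        rewrite (eq_bigr (fun j => (z 0 j - xs 0 j) ^+ 2)); first by clear; ring.
        by move=> j /andP[_ ji]; rewrite add_e_coord (negbTE ji) mulr0 addr0.
      rewrite QE add_e_coord [0 == i]eq_sym /p (negbTE i0) mulr0 addr0 subrr add0r.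
      move: mg; move: ('D__ _ _) (g (z + _) - _) => b1 b2.
      by clear; lra.
    + by move=> i; have [_ d2] := dx i.
    + move=> s /andP[s1 s2]; have hs : T0 <= s < t.
        rewrite s2 andbT; have : ein <= t - T0 by rewrite /ein !ge_min lexx !orbT.
        by clear -s1; lra.
      have := kpos s z hs Dz; rewrite /k subr_gt0 kzE /zeta /= => /ltW; apply: le_trans.
      by rewrite -addrA lerD2l -mulrDr; have -> : t - T0 + (s - t) = s - T0 by clear; ring.
  have pb : `|\sum_j p j ^+ 2 - 1| <= (3 + n.+2%:R) * w.
    have mD j : `|mu * 'D_(e_ R j) g z| <= mu * G by rewrite normrM gtr0_norm// ler_pM2l.
    have thL0 : 0 < 2 * th * L by rewrite !mulr_gt0.
    apply: (sum_sqr_near1 p s0 w).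
    + by rewrite w1 ltW.
    + exact: s0E.
    + rewrite /p eqxx addrAC subrr add0r (le_trans (mD 0))//.
      by clear -hw thL0; lra.
    + move=> j j0; rewrite /p (negbTE j0) (le_trans (ler_normD _ _))//.
      have : `|- (2 * th * (z 0 j - xs 0 j))| <= 2 * th * L.
        rewrite normrN normrM gtr0_norm ?mulr_gt0// ler_pM2l ?mulr_gt0//; exact: Dj.
      have := mD j; move: `|_| `|_| => b1 b2; clear -hw; lra.
  have Ub : 0 < u t z <= 1 - e.
    case/andP: uz' => -> u1 /=; apply/ltW; apply: (Thlt _ _ _ (ltW u1) ThuE).
    by clear -e4 e0; lra.
  have [_ hC hf] := dq (u t z) Ub.
  have := qq0 (u t z).
  rewrite sumr_const card_ord -[(_ + _) *+ _]mulr_natl in touch.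
  move: (q _) (f _) (h _) (\sum_j _) touch pb hC hf => Qz F H S touch pb hC hf Qq.
  (* Since S is close to 1, f + h S >= 3 kap / 4. The contact inequality would then give 3 q0 kap /
     4 <= q0 kap / 4 + q0 kap / 4, the speed plus the curvature budget. *)
  have h1 : - (kap / 4) <= H * (S - 1).
    rewrite lerNl (le_trans _ c1)// (le_trans (ler_norm _))// normrN normrM.
    by apply: ler_pM.
  have h2 : kap * (3 / 4) <= F + H * S by clear -h1 hf; lra.
  have h3 : q0 * (kap * (3 / 4)) <= Qz * (F + H * S).
    by apply: ler_pM => //; rewrite ?(ltW q00)// mulr_ge0// ltW.
  have h4 : 0 < q0 * kap by rewrite mulr_gt0.
  by rewrite sgE in touch c2; clear -h3 h4 touch c2; lra.
Qed.

Theorem theorem4p4 (R : realType) (n : nat) (f : R -> R) (alpha c : R)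
  (phi : R -> R) (K : set 'rV[R]_n.+2) (g : 'rV[R]_n.+2 -> R) (M : R)
  (u : R -> 'rV[R]_n.+2 -> R) (v : 'rV[R]_n.+2 -> R) :
  bistable f alpha -> 0 < c -> traveling_wave f c phi alpha ->
  wall K g M -> dir_convex_x1 K ->
  entire_solution f K g u -> front_at_minus_infty c phi K u ->
  (forall x, (~` K) x -> u t x @[t --> +oo] --> v x) ->
  propagation K v ->
  forall x, (~` K) x -> v x = 1.
Proof.
move=> bf _ [_ [_ [_ [phi1 _]]]] [_ [_ [KM [[us [KE [delta [d0 gd]]]] _]]]] dc sol front uv prop x Kx.
have cf : continuous f.
  have [_ [df _]] := bf => y.
  by apply: differentiable_continuous; apply/derivable1_diffP; exact: df.
have [G G0 [gG dgG cg gT]] := unif_smooth_bounds g us.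
have [a gdir] := dir_convex_grad K g G KE gT dc.
have [el el0 Hl] := left_state f alpha c phi K g M u bf phi1 KM sol front.
have [ep ep0 Hp] := bistable_wave_profile f alpha bf.
have key (e : R) : 0 < e -> e < el -> e < ep -> exists T : R, forall t, T <= t -> 1 - 2 * e < u t x.
  move=> e0 eel eep.
  (* Half of e is used on the left, so that both sides of the slab receive the same bound 1 - e. *)
  have [Al [Tl HTl]] := Hl (e / 2) ltac:(clear -e0 eel; lra).
  have [Ar HAr] := right_state f K g M u v cf KM sol uv prop e e0.
  have [md [kap [Z [q0 [Ch [[_ kap0 _ q00 Ch0] e4 _ HA]]]]]] := Hp e ltac:(by rewrite e0).
  (* The slab of half-width A around a contains x, and its two faces lie in the regions governed by
     the left and right states. *)
  have [A AE] : exists A : R, A = `|x 0 0 - a| + `|Al + a| + `|Ar - a|.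
    by exists (`|x 0 0 - a| + `|Al + a| + `|Ar - a|).
  have n1 := normr_ge0 (x 0 0 - a); have n2 := normr_ge0 (Al + a).
  have n3 := normr_ge0 (Ar - a).
  have A0 : 0 <= A by rewrite AE !addr_ge0.
  have xA : `|x 0 0 - a| <= A by rewrite AE -addrA lerDl addr_ge0.
  have AlA : a - A <= - Al.
    by have := ler_norm (Al + a); rewrite AE; move: `|Al + a| n2 => y n2; clear -n1 n2 n3; lra.
  have ArA : Ar <= a + A.
    by have := ler_norm (Ar - a); rewrite AE; move: `|Ar - a| n3 => y n3; clear -n1 n2 n3; lra.
  have [Th [q [h [wp _ ThA]]]] := HA (A + 2).
  have Thb0 : 0 <= Th (1 - 2 * e).
    have [_ _ Th0 _] := wp.
    have := wave_profile_incr f Th q h _ kap q0 Ch wp 0 (1 - 2 * e) (lexx _)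
      ltac:(clear -e4 e0; lra) ltac:(clear -e0; lra).
    by rewrite Th0 !subr0; apply: le_trans; rewrite mulr_ge0 ?(ltW q00)//; clear -e4 e0; lra.
  have E0 : 0 < A + 2 + Th (1 - 2 * e) by clear -A0 Thb0; lra.
  have N0 : 0 < n.+2%:R :> R by rewrite ltr0n.
  have [mu [L [w cst]]] := barrier_constants _ G _ q0 kap Ch delta N0 G0 E0 q00 kap0 Ch0 d0.
  have [Tr HTr] := HAr (a + A) L ArA x.
  (* The lateral bounds hold at all later times, so for each t the sweep can be started exactly one
     sweep duration before t. *)
  exists (Num.max Tl Tr + (A + 2 + Th (1 - 2 * e)) / (q0 * kap / 4)) => t Tt.
  have tE : t = (t - (A + 2 + Th (1 - 2 * e)) / (q0 * kap / 4))
      + (A + 2 + Th (1 - 2 * e)) / (q0 * kap / 4) by rewrite subrK.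
  rewrite tE; apply: (middle_state f Th q h e kap q0 Ch K g u G delta a A mu L w _ x wp _ sol KE
    _ d0 gd gdir A0 ThA cst xA).
  - by split.
  - by split.
  - by move: Kx; rewrite KE /= => /negP; rewrite -ltNge.
  move=> t' y; rewrite lerBlDr => /(le_trans Tt); rewrite lerD2r ge_max => /andP[Tlt Trt] yA yL.
  have [ya|ya] := leP 0 (y 0 0 - a).
    by apply: (HTr t' y Trt _ yL); rewrite -yA ger0_norm// addrC subrK.
  have yAl : y 0 0 <= - Al.
    by apply: le_trans AlA; rewrite -yA ltr0_norm// opprK addrC subrK.
  by have := HTl t' y Tlt yAl; clear; lra.
have u1 : forall t, u t x < 1.
  by move=> t; have [_ [_ [_ [_ [_ [_ /(_ t x Kx)/andP[]]]]]]] := sol.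
apply/eqP; rewrite eq_le; apply/andP; split.
  rewrite leNgt; apply/negP => v1.
  have : \forall t \near +oo, 1 < u t x by exact: (cvgr_gt _ (uv x Kx)).
  move=> [T [_ HT]]; have := HT (T + 1) ltac:(by rewrite ltrDl).
  by rewrite /= ltNge ltW.
rewrite leNgt; apply/negP => v1.
(* Then v x <= 1 - 4e, so u(t, x) < 1 - 2e at late times, contradicting [key]. *)
pose e := Num.min (Num.min el ep) (1 - v x) / 4.
have m0 : 0 < Num.min (Num.min el ep) (1 - v x) by rewrite !lt_min el0 ep0 subr_gt0.
have e0 : 0 < e by rewrite divr_gt0.
have : e * 4 <= Num.min (Num.min el ep) (1 - v x) by rewrite /e divfK.
rewrite !le_min => /andP[/andP[e1 e2] e3].
have [T HT] := key e e0 ltac:(clear -e0 e1; lra) ltac:(clear -e0 e2; lra).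
have : \forall t \near +oo, u t x < 1 - 2 * e.
  by apply: (cvgr_lt _ (uv x Kx)); clear -e0 e3; lra.
move=> [S [_ HS]]; pose t := Num.max T (S + 1).
have Tt : T <= t by rewrite le_max lexx.
have St : S < t by rewrite lt_max ltrDl ltr01 orbT.
by have := HT t Tt; rewrite ltNge ltW//; exact: (HS t St).
Qed.
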